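(* In the standing setting described in the context, for $\alpha>0$ let $(R_\alpha,U_\alpha,e_\alpha,S_\alpha)$ denote the IGR traveling wave normalized so that $R_\alpha(0)=R_s$. Then, as $\alpha\to0^+$, $$R_\alpha(\xi)\to\begin{cases}R_-,&\xi<0,\\ R_+,&\xi>0.\end{cases}$$ The convergence holds locally uniformly on $(-\infty,0)\cup(0,\infty)$ with exponential rate, i.e. for every compact $K\subset(-\infty,0)\cup(0,\infty)$ there are constants $C,\kappa,\alpha_0>0$ such that the supremum over $K$ of the absolute difference between $R_\alpha$ and its limit is at most $Ce^{-\kappa/\sqrt\alpha}$ for all $0<\alpha<\alpha_0$. Analogous statements hold for $U_\alpha$ (with limit $U_-$ for $\xi<0$, $U_+$ for $\xi>0$), $e_\alpha$ (with limit $e_-$ for $\xi<0$, $e_+$ for $\xi>0$) and $S_\alpha$ (with limit $0$).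
   Context: Standing setting (all data below are independent of $\alpha$; $\alpha>0$ is a varying parameter). Fix a physical equation of state $\tilde p:(0,\infty)\times\mathbb R\to\mathbb R$, $(\rho,e)\mapsto\tilde p(\rho,e)$, of class $C^2$, real numbers $c,m,q,k$ with $m\neq0$, and end states $R_\pm>0$, $U_\pm,\mathcal E_\pm\in\mathbb R$. Put $e_\pm=\mathcal E_\pm/R_\pm-\frac12U_\pm^2$ and assume the Rankine–Hugoniot relations $R_\pm(U_\pm-c)=m$, $mU_\pm+\tilde p(R_\pm,e_\pm)=q$, $(\mathcal E_\pm+\tilde p(R_\pm,e_\pm))U_\pm-c\,\mathcal E_\pm=k$. For $R>0$ define $$e(R)=e_0+\frac{A}{R}+\frac{m^2}{2R^2},\quad e_0=\frac{k-qc+\frac m2c^2}{m},\quad A=mc-q,$$ the reduced pressure $p(R)=\tilde p(R,e(R))$, and $\mathcal S(R)=q-mc-\frac{m^2}{R}-p(R)$. (Then $e(R_\pm)=e_\pm$ and $\mathcal S(R_\pm)=0$.) Primes denote $d/dR$, dots denote $d/d\xi$. Assume: (1) $R_-<R_+$; (2) Lax inequalities: $U_--\sqrt{p'(R_-)}>c>U_+-\sqrt{p'(R_+)}$ (with $p'(R_\pm)\ge0$); equivalently $m>0$, $\frac{m^2}{R_-^2}-p'(R_-)>0$ and $\frac{m^2}{R_+^2}-p'(R_+)<0$; (3) $p\in C^2((0,\infty))$, and one of the following convexity criteria holds along $(\rho,e)=(R,e(R))$ for $R\in[R_-,R_+]$: (A) the matrix $\begin{pmatrix}\tilde p_{\rho\rho}+\frac{m^2}{R^4}\tilde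 p_e&\tilde p_{\rho e}-\frac1R\tilde p_e\\ \tilde p_{\rho e}-\frac1R\tilde p_e&\tilde p_{ee}\end{pmatrix}$ is positive semidefinite; or (B) $\tilde p_{\rho\rho}\ge0$, $\tilde p_{ee}\ge0$, $\tilde p_e\ge0$, $\tilde p_{\rho e}\ge\frac1R\tilde p_e$, $e'(R)\ge0$. In particular $p''(R)\ge0$, and this inequality is assumed for all $R>0$; (4) $p''$ is Lipschitz in a neighborhood of $R_s$, where the sonic density $R_s\in(R_-,R_+)$ is the unique zero of $\mathcal S'$ in $(0,\infty)$. For $\alpha>0$, $R_\alpha$ is the unique nondecreasing function $R:\mathbb R\to[R_-,R_+]$ in $W^{1,2}_{\mathrm{loc}}(\mathbb R)$ with $R(\xi)\to R_\pm$ as $\xi\to\pm\infty$, normalized by $R(0)=R_s$, such that for every $\varphi\in C_c^\infty(\mathbb R)$ $$\int_{\mathbb R}\alpha\frac{\mathcal S'(R)}{R}\dot R\,\dot\varphi\,d\xi+\int_{\mathbb R}\Big(\frac{\mathcal S(R)}{R}-2\alpha\frac{m^2}{R^4}\dot R^2\Big)\varphi\,d\xi=0,$$ and $U_\alpha=c+m/R_\alpha$, $e_\alpha=e(R_\alpha)$, $S_\alpha=\mathcal S(R_\alpha)$. *)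

(* Defs.v *)
From HB Require Import structures.
From mathcomp Require Import all_boot all_order all_algebra.
From mathcomp Require Import all_classical all_reals all_analysis.
Set Implicit Arguments.
Unset Strict Implicit.
Unset Printing Implicit Defensive.
Import Order.TTheory GRing.Theory Num.Theory.
Import numFieldNormedType.Exports.
Local Open Scope ring_scope.
Local Open Scope classical_set_scope.

Section PressureLaws.
Variable R : realType.
Implicit Types (f : R -> R -> R) (p : R -> R).

Definition partial1 f : R -> R -> R := fun rho e => (fun r => f r e)^`() rho.
Definition partial2 f : R -> R -> R := fun rho e => (f rho)^`() e.

(* Functions on (0,oo) x R are total functions constrained only where rho > 0;
   joint continuity is expressed at the points of this open half-plane. *)
Definition C0_halfplane f : Prop :=
  forall rho e : R, 0 < rho ->
    {for (rho, e), continuous (fun z : R * R => f z.1 z.2)}.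

Definition C1_halfplane f : Prop :=
  [/\ C0_halfplane f, C0_halfplane (partial1 f), C0_halfplane (partial2 f)
    & forall rho e : R, 0 < rho ->
        derivable (fun r => f r e) rho 1 /\ derivable (f rho) e 1].

Definition C2_halfplane f : Prop :=
  [/\ C1_halfplane f, C1_halfplane (partial1 f) & C1_halfplane (partial2 f)].

Definition C2_pos p : Prop :=
  forall r : R, 0 < r ->
    [/\ derivable p r 1, derivable p^`() r 1 & {for r, continuous p^`(2)}].

Definition psdmx (n : nat) (M : 'M[R]_n) : Prop :=
  M^T = M /\ forall v : 'rV[R]_n, 0 <= (v *m M *m v^T) 0 0.

(* the symmetric matrix ((a, b), (b, d)) *)
Definition symmx2 (a b d : R) : 'M[R]_(1 + 1) :=
  block_mx a%:M b%:M b%:M d%:M.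

End PressureLaws.

Record state (R : realType) := State {
  dens : R; (* mass density R *)
  vel : R;  (* velocity U *)
  ener : R  (* total energy per unit volume, calligraphic E *)
}.

Record shock_data (R : realType) := ShockData {
  eos : R -> R -> R; (* physical pressure, as a function of (rho, e) *)
  speed : R;         (* c *)
  mass_flux : R;     (* m *)
  mom_flux : R;      (* q *)
  ener_flux : R;     (* k *)
  lstate : state R;
  rstate : state R
}.

Section Shock.
Variable R : realType.
Implicit Types (d : shock_data R) (s : state R) (r : R).

Definition state_int_energy s : R := ener s / dens s - vel s ^+ 2 / 2.

Definition rankine_hugoniot d s : Prop :=
  let: (c, m) := (speed d, mass_flux d) in
  let P := eos d (dens s) (state_int_energy s) in
  [/\ dens s * (vel s - c) = m,
      m * vel s + P = mom_flux d
    & (ener s + P) * vel s - c * ener s = ener_flux d].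

Definition int_energy d : R -> R := fun r =>
  let: (c, m, q, k) := (speed d, mass_flux d, mom_flux d, ener_flux d) in
  (k - q * c + m / 2 * c ^+ 2) / m + (m * c - q) / r
    + m ^+ 2 / (2 * r ^+ 2).

Definition reduced_pressure d : R -> R := fun r => eos d r (int_energy d r).

(* calligraphic S *)
Definition entropic_pressure d : R -> R := fun r =>
  mom_flux d - mass_flux d * speed d - mass_flux d ^+ 2 / r
    - reduced_pressure d r.

Definition velocity d : R -> R := fun r => speed d + mass_flux d / r.

Definition lax_inequalities d : Prop :=
  let p' := (reduced_pressure d)^`() in
  let: (l, r) := (lstate d, rstate d) in
  [/\ 0 <= p' (dens l), 0 <= p' (dens r),
      vel l - Num.sqrt (p' (dens l)) > speed d
    & speed d > vel r - Num.sqrt (p' (dens r))].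

Definition convexityA d r : Prop :=
  let: (pt, m, e) := (eos d, mass_flux d, int_energy d r) in
  psdmx (symmx2
    (partial1 (partial1 pt) r e + m ^+ 2 / r ^+ 4 * partial2 pt r e)
    (partial2 (partial1 pt) r e - r^-1 * partial2 pt r e)
    (partial2 (partial2 pt) r e)).

Definition convexityB d r : Prop :=
  let: (pt, e) := (eos d, int_energy d r) in
  [/\ 0 <= partial1 (partial1 pt) r e, 0 <= partial2 (partial2 pt) r e,
      0 <= partial2 pt r e,
      partial2 (partial1 pt) r e >= r^-1 * partial2 pt r e
    & 0 <= (int_energy d)^`() r].

Definition convexity_criterion d : Prop :=
  (forall r, dens (lstate d) <= r <= dens (rstate d) -> convexityA d r) \/
  (forall r, dens (lstate d) <= r <= dens (rstate d) -> convexityB d r).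

Definition sonic_density d (Rs : R) : Prop :=
  let S' := (entropic_pressure d)^`() in
  [/\ dens (lstate d) < Rs, Rs < dens (rstate d), S' Rs = 0
    & forall r, 0 < r -> S' r = 0 -> r = Rs].

Definition lipschitz_near (f : R -> R) (a : R) : Prop :=
  exists2 A : set R, nbhs a A & [lipschitz f x | x in A].

End Shock.

Section Profiles.
Variable R : realType.
Notation mu := (@lebesgue_measure R).

Definition test_function (phi : R -> R) : Prop :=
  (forall (n : nat) (x : R), derivable phi^`(n) x 1) /\
  compact (closure [set x | phi x != 0]).

Definition L2loc (f : R -> R) : Prop :=
  measurable_fun setT f /\ locally_integrable setT (fun x => f x ^+ 2).

Definition weak_derivative (f g : R -> R) : Prop :=
  forall phi : R -> R, test_function phi ->
    \int[mu]_x (f x * phi^`()%classic x) = - \int[mu]_x (g x * phi x).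

(* f is in W^{1,2}_loc with weak derivative g *)
Definition W12loc (f g : R -> R) : Prop :=
  [/\ L2loc f, L2loc g & weak_derivative f g].

(* g stands for the weak derivative of f *)
Definition igr_weak_equation (d : shock_data R) (alpha : R) (f g : R -> R) :
    Prop :=
  let S := entropic_pressure d in
  let m := mass_flux d in
  forall phi : R -> R, test_function phi ->
    \int[mu]_xi (alpha * (S^`()%classic (f xi) / f xi) * g xi * phi^`()%classic xi)
    + \int[mu]_xi ((S (f xi) / f xi
                    - 2 * alpha * (m ^+ 2 / f xi ^+ 4) * g xi ^+ 2) * phi xi)
    = 0.

Definition igr_traveling_wave (d : shock_data R) (Rs alpha : R) (f : R -> R) :
    Prop :=
  let: (Rl, Rr) := (dens (lstate d), dens (rstate d)) in
  [/\ {homo f : x y / x <= y},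
      forall xi, Rl <= f xi <= Rr,
      f xi @[xi --> -oo] --> Rl /\ f xi @[xi --> +oo] --> Rr,
      f 0 = Rs
    & exists2 g : R -> R, W12loc f g & igr_weak_equation d alpha f g].

(* the value at 0 plays no role: 0 is excluded below *)
Definition step (l r : R) : R -> R := fun xi => if xi < 0 then l else r.

Definition cvg_step_pointwise (F : R -> R -> R) (l r : R) : Prop :=
  forall xi : R, xi != 0 -> F alpha xi @[alpha --> 0^'+] --> step l r xi.

Definition cvg_step_exp (F : R -> R -> R) (l r : R) : Prop :=
  forall K : set R, compact K ->
    K `<=` [set xi | xi < 0] `|` [set xi | 0 < xi] ->
    exists C kappa alpha0 : R, [/\ 0 < C, 0 < kappa, 0 < alpha0 &
      forall alpha, 0 < alpha < alpha0 -> forall xi, K xi ->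
        `|F alpha xi - step l r xi| <= C * expR (- kappa / Num.sqrt alpha)].

Definition cvg_step (F : R -> R -> R) (l r : R) : Prop :=
  cvg_step_pointwise F l r /\ cvg_step_exp F l r.

End Profiles.

(* Main.v *)
(* Away from the sonic point the weak equation is a genuine ODE: by du
   Bois-Reymond the flux alpha S'(R) R^./R has a continuous representative, so the
   logarithmic slope w = R^./R is differentiable and satisfies
     alpha S'(R) w^. = S(R)/R + alpha p''(R) R w^2.
   A plateau at the sonic density is impossible, since there the flux vanishes
   while the source is positive; hence R < R_s on xi < 0 and R > R_s on xi > 0.
   As p'' >= 0 and S is concave with S(R_-) = S(R_+) = 0, the ODE yields, with
   T = R_- on the left and T = R_+ on the right, that alpha w^2 - (R - T)^2/R_+^2
   decreases away from the shock while (R - T)^2 tends to 0, so it is >= 0: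
   sqrt alpha |R^.| >= (R_-/R_+) |R - T|, which is exponential decay at rate
   1/sqrt alpha, uniformly over all weak solutions.  The other quantities are C^1
   functions of R. *)
Require Import Defs.
From mathcomp Require Import all_boot all_order all_algebra.
From mathcomp Require Import ring lra.
From mathcomp Require Import all_classical all_reals all_analysis.
From mathcomp Require Import measurable_realfun.
Import Order.TTheory GRing.Theory Num.Theory.
Import numFieldNormedType.Exports.
Local Open Scope ring_scope.
Local Open Scope classical_set_scope.
Set Implicit Arguments.
Unset Strict Implicit.
Unset Printing Implicit Defensive.

(** * Smooth test functions *)

Section RealDerivatives.
Variable R : realType.
Implicit Types (f : R -> R) (x : R).

(** The obstacle is the degeneracy of the equation: its coefficient S' vanishes at the sonic
    density, so it cannot be divided out at the shock, and every estimate lives on an open half-line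
    that excludes [0]. The monotone quantity arises as follows, say on the left. Concavity puts the
    graph of S below its tangents, so S(R_-) = 0 gives S(R) >= S'(R) (R - R_-); since p'' >= 0 and
    S' > 0 there, the ODE yields alpha w^. >= (R - R_-)/R. Multiplying by 2 w = 2 R^./R and using R
    <= R_+, the derivative of alpha w^2 is at least 2 (R - R_-) R^./R_+^2, which is that of (R -
    R_-)^2/R_+^2. Nothing about the limit of w at infinity enters. No limit is taken in the
    equation: [alpha] stays fixed, and the constants depend on the end states alone. Test functions
    must be differentiable to every order, so they are built explicitly from exp(-1/x). *)

Lemma is_derive1_bound f x l :
  (forall e : R, 0 < e -> exists2 r : R, 0 < r & forall y, `|y - x| < r ->
     `|f y - f x - l * (y - x)| <= e * `|y - x|) ->
  is_derive x (1 : R) f l.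
Proof.
move=> fl.
have cv : h^-1 *: (f (h + x) - f x) @[h --> 0^'] --> l.
  apply/cvgrPdist_le => /= e /fl[r r0 hr].
  near=> h.
  have h0 : h != 0 by near: h; exact: nbhs_dnbhs_neq.
  have hr' : `|h| < r by near: h; exact: dnbhs0_lt.
  have := hr (h + x); rewrite addrK => /(_ hr').
  have -> : f (h + x) - f x - l * h = - (h * (l - h^-1 * (f (h + x) - f x))).
    by field.
  by rewrite normrN normrM mulrC ler_pM2r// normr_gt0.
suff H : h^-1 *: (f (h *: (1 : R) + x) - f x) @[h --> 0^'] --> l.
  apply: DeriveDef; first by apply/cvg_ex; exists l.
  exact: cvg_lim.
by under eq_fun do rewrite [_ *: 1]mulr1.
Unshelve. all: by end_near. Qed.

Lemma is_derive1_continuous f x l : is_derive x (1 : R) f l ->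
  {for x, continuous f}.
Proof.
by move=> [df _]; apply: differentiable_continuous; exact/derivable1_diffP.
Qed.

Lemma derivable_continuous f : (forall x, derivable f x 1) -> continuous f.
Proof.
by move=> df x; apply: differentiable_continuous; apply/derivable1_diffP.
Qed.

Lemma is_derive1_inv x : x != 0 ->
  is_derive x (1 : R) (fun y : R => y^-1) (- x ^- 2).
Proof.
by move=> x0; apply: is_derive_eq; [exact: is_deriveV|rewrite /GRing.scale/= mulr1].
Qed.

Lemma continuous_exprnV n x : 0 < x -> {for x, continuous (fun y : R => y ^- n)}.
Proof.
move=> x0; apply: cvgV; first by rewrite gt_eqF// exprn_gt0.
exact: exprn_continuous.
Qed.

End RealDerivatives.

Section SmoothStep.
Variable R : realType.
Implicit Types (f : R -> R) (x : R).

(** [flat 0] is the classical exp(-1/x) extended by zero. The powers of 1/x are carried along so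
    that the derivative of a member is a combination of two others, and smoothness of every order
    follows by induction. *)
Definition flat (n : nat) x : R :=
  if 0 < x then x^-1 ^+ n * expR (- x^-1) else 0.

Lemma flat_ge0 n x : 0 <= flat n x.
Proof.
rewrite /flat; case: ifPn => // x0.
by rewrite mulr_ge0 ?expR_ge0// exprn_ge0// invr_ge0 ltW.
Qed.

(** For positive [n], exp(u) is the n-th power of exp(u/n), which is at least u/n. *)
Lemma exprn_le_expR n (u : R) : 0 <= u -> u ^+ n <= n%:R ^+ n * expR u.
Proof.
case: n => [|n] u0; first by rewrite !expr0 mul1r -expR0 ler_expR.
have -> : u = n.+1%:R * (u / n.+1%:R) by rewrite mulrC divfK.
rewrite expRM_natl exprMn ler_wpM2l ?exprn_ge0// lerXn2r ?nnegrE ?expR_ge0//.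
  by rewrite divr_ge0.
by apply: le_trans (expR_ge1Dx _); rewrite lerDr.
Qed.

(** The exponential bound with exponent [n.+2] leaves a spare factor [x ^+ 2], which makes the
    derivative at [0] vanish. *)
Lemma flat_quadratic n x : flat n x <= n.+2%:R ^+ n.+2 * x ^+ 2.
Proof.
rewrite /flat; case: ifPn => x0; last by rewrite mulr_ge0 ?sqr_ge0 // exprn_ge0.
have xi : 0 <= x^-1 by rewrite invr_ge0 ltW.
have h := exprn_le_expR n.+2 xi.
have -> : x^-1 ^+ n = x^-1 ^+ n.+2 * x ^+ 2.
  by rewrite -addn2 exprD -mulrA -exprMn mulVf ?gt_eqF// expr1n mulr1.
rewrite mulrAC expRN ler_pM2r ?exprn_gt0// ler_pdivrMr ?expR_gt0//.
Qed.

Lemma is_derive_flat n x :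
  is_derive x (1 : R) (flat n) (flat n.+2 x - n%:R * flat n.+1 x).
Proof.
have [x0|x0|->] := ltgtP x 0.
- have -> : flat n.+2 x - n%:R * flat n.+1 x = 0.
    by rewrite /flat !ifN ?mulr0 ?subrr// -leNgt ltW.
  apply: (@near_eq_is_derive _ _ _ (cst 0)).
  near=> y; rewrite /flat ifN// -leNgt ltW//.
  by near: y; exact: lt_nbhsl.
- rewrite /(flat _.+2) /(flat _.+1) x0.
  have xn0 : x != 0 by rewrite gt_eqF.
  apply: (@near_eq_is_derive _ _ _ (fun y : R => y^-1 ^+ n * expR (- y^-1) : R)).
    near=> y; rewrite /flat ifT//.
    by near: y; exact: lt_nbhsr.
  have -> : (fun y : R => y^-1 ^+ n * expR (- y^-1) : R) =
      (fun y : R => y^-1) ^+ n * (expR \o (fun y : R => - y^-1)).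
    by apply/funext => y; rewrite !fctE /=.
  apply: is_derive_eq.
    apply: is_deriveM.
      apply: is_deriveX.
      exact: is_deriveV.
    apply: is_derive1_comp.
    apply: is_deriveN.
    exact: is_deriveV.
  rewrite /GRing.scale /=.
  rewrite !fctE /= -exprVn.
  by case: n => [|n]; rewrite /= ?expr0 ?exprS; ring.
- rewrite /(flat _.+2) /(flat _.+1) ltxx mulr0 subr0.
  apply: is_derive1_bound => e e0.
  pose C : R := n.+2%:R ^+ n.+2.
  have C0 : 0 < C by rewrite exprn_gt0.
  exists (e / C); first by rewrite divr_gt0.
  move=> y; rewrite subr0 mul0r subr0 {2}/flat ltxx subr0 => yC.
  rewrite ger0_norm ?flat_ge0// (le_trans (flat_quadratic n y))//.
  rewrite -/C -real_normK ?num_real// expr2 mulrA ler_wpM2r//.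
  by rewrite mulrC -ler_pdivlMr// ltW.
Unshelve. all: by end_near. Qed.

(* Closed under differentiation, so its members are infinitely differentiable. *)
Inductive elementary_smooth : (R -> R) -> Prop :=
| es_flat n : elementary_smooth (flat n)
| es_cst c : elementary_smooth (fun=> c)
| es_affine f a b : elementary_smooth f ->
    elementary_smooth (fun x => f (a * x + b))
| es_add f g : elementary_smooth f -> elementary_smooth g ->
    elementary_smooth (fun x => f x + g x)
| es_mul f g : elementary_smooth f -> elementary_smooth g ->
    elementary_smooth (fun x => f x * g x)
| es_inv f : elementary_smooth f -> (forall x, f x != 0) ->
    elementary_smooth (fun x => (f x)^-1).

Lemma elementary_smooth_is_derive f : elementary_smooth f ->
  exists2 f', elementary_smooth f' & forall x, is_derive x (1 : R) f (f' x).
Proof.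
elim=> {f} [n|c|f a b _ [f' sf' df]|f g _ [f' sf' df] _ [g' sg' dg]|
  f g sf [f' sf' df] sg [g' sg' dg]|f sf [f' sf' df] f0].
- exists (fun x => flat n.+2 x + (- n%:R) * flat n.+1 x).
    apply: es_add; first exact: es_flat.
    by apply: es_mul; [exact: es_cst|exact: es_flat].
  by move=> x; rewrite mulNr; exact: is_derive_flat.
- by exists (fun=> 0); [exact: es_cst|move=> x; exact: is_derive_cst].
- exists (fun x => a * f' (a * x + b)).
    by apply: es_mul; [exact: es_cst|exact: es_affine].
  move=> x; rewrite mulrC; apply: (@is_derive1_comp _ f (fun x => a * x + b)).
  apply: is_derive_eq; rewrite /GRing.scale/=.
  by rewrite mulr1 addr0.
- exists (fun x => f' x + g' x); first exact: es_add.
  by move=> x; exact: is_deriveD.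
- exists (fun x => f x * g' x + g x * f' x).
    by apply: es_add; exact: es_mul.
  by move=> x; exact: is_deriveM.
- exists (fun x => (-1) * (f x)^-1 * (f x)^-1 * f' x).
    apply: es_mul => //; apply: es_mul; last exact: es_inv.
    by apply: es_mul; [exact: es_cst|exact: es_inv].
  move=> x; apply: (is_derive_eq (is_deriveV (f0 x) (df x))).
  by rewrite /GRing.scale/= -exprVn expr2; ring.
Qed.

Lemma elementary_smooth_derive1n f n : elementary_smooth f ->
  elementary_smooth f^`(n).
Proof.
move=> sf; elim: n => [|n /elementary_smooth_is_derive[g sg dg]].
  by rewrite derive1n0.
rewrite derive1nS (_ : _^`() = g)//.
by apply/funext => x; rewrite derive1E derive_val.
Qed.

Lemma elementary_smooth_derivable f n x : elementary_smooth f ->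
  derivable f^`(n) x 1.
Proof.
move=> /(elementary_smooth_derive1n n)/elementary_smooth_is_derive[g _ /(_ x) dg].
exact: ex_derive.
Qed.

(* [- 1 * x + 1] has the shape required by [es_affine]; likewise [ramp] and
   [plateau] below. *)
Definition smooth_step x : R := flat 0 x * (flat 0 x + flat 0 (- 1 * x + 1))^-1.

Lemma flat_gt0 n x : 0 < x -> 0 < flat n x.
Proof. by move=> x0; rewrite /flat x0 mulr_gt0 ?expR_gt0 ?exprn_gt0 ?invr_gt0. Qed.

Lemma smooth_step_den x : 0 < flat 0 x + flat 0 (- 1 * x + 1).
Proof.
have [x0|x0] := ltP 0 x; first by rewrite ltr_pwDl ?flat_gt0 ?flat_ge0.
by rewrite ltr_wpDl ?flat_ge0 ?flat_gt0//; lra.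
Qed.

Lemma elementary_smooth_step : elementary_smooth smooth_step.
Proof.
apply: es_mul; first exact: es_flat.
apply: es_inv; last by move=> x; rewrite gt_eqF ?smooth_step_den.
by apply: es_add; [exact: es_flat|apply: es_affine; exact: es_flat].
Qed.

Lemma smooth_step_le0 x : x <= 0 -> smooth_step x = 0.
Proof. by move=> x0; rewrite /smooth_step {1}/flat ltNge x0 mul0r. Qed.

Lemma smooth_step_ge1 x : 1 <= x -> smooth_step x = 1.
Proof.
move=> x1; have : flat 0 (- 1 * x + 1) = 0.
  by rewrite /flat ltNge (_ : _ <= _)//; lra.
rewrite /smooth_step => ->; rewrite addr0 divff// gt_eqF// flat_gt0//.
exact: lt_le_trans x1.
Qed.

Lemma smooth_step_itv x : 0 <= smooth_step x <= 1.
Proof.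
rewrite /smooth_step; have d := smooth_step_den x.
rewrite divr_ge0 ?flat_ge0 ?(ltW d)//= ler_pdivrMr// mul1r lerDl.
exact: flat_ge0.
Qed.

End SmoothStep.

(** * Local integrability and almost-everywhere statements *)

Section LocalIntegrability.
Variable R : realType.
Notation mu := (@lebesgue_measure R).
Implicit Types (f g h : R -> R) (u v x y t : R).

Lemma locally_integrable_itv f (i : interval R) u v :
  locally_integrable setT f -> [set` i] `<=` `[u, v] ->
  mu.-integrable [set` i] (EFin \o f).
Proof.
move=> [mf _ lf] iuv.
apply: (@integrableS _ _ _ mu `[u, v]%classic) => //.
apply/integrableP; split.
  by apply/measurable_EFinP; exact: measurable_funTS.
by apply: lf => //; exact: segment_compact.
Qed.

Lemma locally_integrable_mulr f h : continuous h ->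
  locally_integrable setT f -> locally_integrable setT (fun x => h x * f x).
Proof.
move=> ch [mf _ lf].
have mh : measurable_fun setT h by exact: continuous_measurable_fun.
split; [exact: measurable_funM|exact: openT|move=> K KT cK].
have mK : measurable K by exact: compact_measurable.
have iK : mu.-integrable K (EFin \o f).
  apply/integrableP; split; last exact: lf.
  by apply/measurable_EFinP; exact: measurable_funTS.
have bK : [bounded h x | x in K].
  have /compact_bounded[M [_ Mh]] := continuous_compact
    (continuous_subspaceT ch) cK.
  by exists M; split; rewrite ?num_real // => ? ? ? ?; exact: Mh.
have /integrableP[] // : mu.-integrable K ((EFin \o h) \* (EFin \o f))%E.
by apply: integrableMr => //; exact: measurable_funTS.
Qed.

Lemma Rintegral_support f u v : (forall t, t \notin `[u, v]%R -> f t = 0) ->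
  \int[mu]_t f t = \int[mu]_(t in `[u, v]) f t.
Proof.
move=> f0; rewrite [RHS]Rintegral_mkcond; apply: eq_Rintegral => t _.
rewrite patchE; case: ifPn => // tuv; apply: f0.
by apply: contra tuv => tuv; rewrite mem_setE.
Qed.

Lemma ae_itvP (P : R -> Prop) u v : {ae mu, forall x, P x} -> u < v ->
  exists2 x, u < x < v & P x.
Proof.
move=> aeP uv; apply: contrapT => nP.
have : mu.-negligible (`]u, v[%classic : set R).
  apply: negligibleS aeP => x /=; rewrite in_itv/= => xuv Px.
  by apply: nP; exists x.
have e : mu `]u, v[%classic = (v - u)%:E.
  by rewrite lebesgue_measure_itv/= lte_fin uv -EFinD.
move=> /negligibleP -/(_ (measurable_itv _)) h.
have : (v - u)%:E = 0%E :> \bar R by rewrite -e; exact: h.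
by move/eqP; rewrite eqe subr_eq0 gt_eqF.
Qed.

End LocalIntegrability.

(** * Rescaled smooth steps and the kernels they generate *)

Section TestFunctions.
Variable R : realType.
Notation mu := (@lebesgue_measure R).
Implicit Types (a b f g : R -> R) (k u v x y t : R).

Definition dstep : R -> R := (@smooth_step R)^`().

Lemma is_derive_smooth_step x : is_derive x (1 : R) (@smooth_step R) (dstep x).
Proof.
rewrite /dstep derive1E; apply: derivableP.
by have := @elementary_smooth_derivable R _ 0 x (@elementary_smooth_step R).
Qed.

Lemma continuous_derive1_smooth_step : continuous dstep.
Proof.
apply: derivable_continuous => x.
by have := @elementary_smooth_derivable R _ 1 x (@elementary_smooth_step R).
Qed.

Lemma derive1_smooth_step_out x : x \notin `[0, 1]%R -> dstep x = 0.
Proof.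
rewrite in_itv/= negb_and -!ltNge => /orP[x0|x1].
- rewrite /dstep derive1E -(derive_cst (0 : R) x (1 : R)).
  apply: near_eq_derive; near=> y; rewrite smooth_step_le0// ltW//.
  by near: y; exact: lt_nbhsl.
- rewrite /dstep derive1E -(derive_cst (1 : R) x (1 : R)).
  apply: near_eq_derive; near=> y; rewrite smooth_step_ge1// ltW//.
  by near: y; exact: lt_nbhsr.
Unshelve. all: by end_near. Qed.

Lemma derive1_smooth_step_bounded : exists2 B, 0 < B & forall x, `|dstep x| <= B.
Proof.
have cn : {within `[0, 1], continuous (fun x => `|dstep x|)}.
  apply: continuous_subspaceT => x; apply: cvg_norm.
  exact: continuous_derive1_smooth_step.
have [c _ hc] := EVT_max ler01 cn.
exists (`|dstep c| + 1); first by rewrite ltr_wpDl.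
move=> x; have [x01|x01] := boolP (x \in `[0, 1]%R).
  by rewrite (le_trans (hc _ x01))// lerDl.
by rewrite derive1_smooth_step_out// normr0 addr_ge0.
Qed.

(** For [k > 0] it climbs from [0] to [1] across [[x, x + k^-1]], so its derivative is a kernel of
    unit mass supported just to the right of [x]. *)
Definition ramp k x t : R := smooth_step (k * t + - (k * x)).

Lemma is_derive_ramp k x t :
  is_derive t (1 : R) (ramp k x) (dstep (k * t + - (k * x)) * k).
Proof.
apply: (@is_derive1_comp _ (@smooth_step R) (fun t => k * t + - (k * x))).
  exact: is_derive_smooth_step.
by apply: is_derive_eq; rewrite /GRing.scale/= mulr1 subr0.
Qed.

Lemma continuous_ramp k x : continuous (ramp k x).
Proof.
by apply: derivable_continuous => t; apply: ex_derive; exact: is_derive_ramp.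
Qed.

Lemma continuous_dramp k x :
  continuous (fun t => dstep (k * t + - (k * x)) * k).
Proof.
move=> t; apply: cvgM; last exact: cvg_cst.
apply: (@continuous_comp _ _ _ (fun t => k * t + - (k * x)) dstep).
  apply: cvgD; last exact: cvg_cst.
  by apply: cvgM; [exact: cvg_cst|exact: cvg_id].
exact: continuous_derive1_smooth_step.
Qed.

Lemma dramp_out k x t : 0 < k -> t \notin `[x, x + k^-1]%R ->
  dstep (k * t + - (k * x)) * k = 0.
Proof.
move=> k0 xt; rewrite derive1_smooth_step_out ?mul0r//.
apply: contra xt; rewrite !in_itv/= -mulrBr => /andP[h1 h2].
move: h1; rewrite pmulr_rge0// subr_ge0 => ->/=.
by rewrite -lerBlDl -[k^-1]mul1r ler_pdivlMr// mulrC.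
Qed.

Lemma Rintegral_dramp k x : 0 < k ->
  \int[mu]_(t in `[x, x + k^-1]) (dstep (k * t + - (k * x)) * k) = 1.
Proof.
move=> k0.
rewrite /Rintegral (@continuous_FTC2 _ _ (ramp k x)).
- rewrite /= /ramp smooth_step_ge1 ?smooth_step_le0 ?subrr ?subr0//.
  by rewrite mulrDr divff ?gt_eqF// addrAC subrr add0r.
- by rewrite ltrDl invr_gt0.
- by apply: continuous_subspaceT; exact: continuous_dramp.
- split.
  + by move=> t _; apply: ex_derive; exact: is_derive_ramp.
  + by apply: cvg_at_right_filter; exact: continuous_ramp.
  + by apply: cvg_at_left_filter; exact: continuous_ramp.
- move=> t _; rewrite derive1E.
  by have := is_derive_ramp k x t => /@derive_val.
Qed.

End TestFunctions.

(** * The du Bois-Reymond lemma *)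

Section DuBoisReymond.
Variable R : realType.
Notation mu := (@lebesgue_measure R).
Implicit Types (a b f g : R -> R) (B k u v x y t : R).

(** The kernel has mass [1], is supported in [[x, x + k^-1]] and is bounded by [B * k]. The doubled
    radius lets the open ball contain that closed interval; the ball has length [4 / k], whence the
    factor [4 * B]. *)
Lemma mollify_dist a k x B : 0 < k -> locally_integrable setT a ->
  (forall t, `|dstep t : R| <= B) ->
  (`|\int[mu]_t (a t * (dstep (k * t + - (k * x)) * k)) - a x|%:E <=
    (4 * B)%:E * davg a x (2 / k))%E.
Proof.
move=> k0 la hB; set psi := fun t => dstep (k * t + - (k * x)) * k.
have B0 : 0 <= B by exact: le_trans (hB 0).
pose y := x + k^-1.
have cpsi : continuous psi by exact: continuous_dramp.
have mpsi : measurable_fun setT psi by exact: continuous_measurable_fun.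
have ma : measurable_fun setT a by case: la.
have iapsi : mu.-integrable `[x, y] (EFin \o (fun t => a t * psi t)).
  rewrite (_ : (fun t => a t * psi t) = (fun t => psi t * a t)); last first.
    by apply/funext => t; rewrite mulrC.
  apply: (@locally_integrable_itv R _ `[x, y]%R x y) => //.
  exact: locally_integrable_mulr.
have ipsi : mu.-integrable `[x, y] (EFin \o psi).
  apply: continuous_compact_integrable; first exact: segment_compact.
  exact: continuous_subspaceT.
have icpsi : mu.-integrable `[x, y] (EFin \o (fun t => a x * psi t)).
  apply: continuous_compact_integrable; first exact: segment_compact.
  apply: continuous_subspaceT => t.
  by apply: cvgM; [exact: cvg_cst|exact: cpsi].
pose D t := a t * psi t - a x * psi t.
have -> : \int[mu]_t (a t * psi t) - a x = \int[mu]_(t in `[x, y]) D t.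
  rewrite RintegralB//.
  rewrite (@RintegralZl _ _ _ mu `[x, y] psi (a x))//.
  rewrite (Rintegral_dramp x k0 : \int[mu]_(t in `[x, y]) psi t = 1) mulr1.
  congr (_ - _); apply: Rintegral_support => t tx.
  by rewrite /psi dramp_out// mulr0.
have iD : mu.-integrable `[x, y] (EFin \o D).
  rewrite (_ : EFin \o D =
      (fun t => (a t * psi t)%:E - (a x * psi t)%:E)%E)//.
  exact: integrableB.
rewrite (@EFin_normr_Rintegral _ _ _ mu `[x, y] D)//.
have md : measurable_fun setT (fun t => `|a t - a x|).
  by apply: measurableT_comp => //; exact: measurable_funB.
apply: le_trans (le_abse_integral _ _ _) _ => //.
  apply/measurable_EFinP; apply: measurable_funTS.
  apply: measurable_funB; apply: measurable_funM => //.
apply: (@le_trans _ _ (\int[mu]_(t in `[x, y]) ((B * k)%:E * `|a t - a x|%:E))%E).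
  apply: ge0_le_integral => //.
  - apply: measurableT_comp => //.
    apply/measurable_EFinP; apply: measurable_funTS.
    by apply: measurable_funB; apply: measurable_funM.
  - apply: measurable_funeM.
    by apply/measurable_EFinP; exact: measurable_funTS.
  - move=> t _; rewrite -EFinM lee_fin /D -mulrBl mulrC normrM ler_wpM2r//.
    by rewrite /psi normrM (gtr0_norm k0) ler_wpM2r ?hB// ltW.
rewrite ge0_integralZl//; last 2 first.
- by apply/measurable_EFinP; exact: measurable_funTS.
- by rewrite lee_fin mulr_ge0// ltW.
apply: (@le_trans _ _ ((B * k)%:E *
    \int[mu]_(t in ball x (2 / k)) `|a t - a x|%:E)%E).
  apply: lee_wpmul2l; first by rewrite lee_fin mulr_ge0// ltW.
  apply: ge0_subset_integral => //.
  - exact: measurable_ball.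
  - by apply/measurable_EFinP; exact: measurable_funTS.
  - move=> t; rewrite /= in_itv/= /ball/= ltr_distlC => /andP[xt ty].
    have h : 0 < k^-1 by rewrite invr_gt0.
    by rewrite (mulrC 2); move: ty; rewrite /y => ty; apply/andP; split; lra.
have k2 : 0 < 2 / k by rewrite divr_gt0.
rewrite /davg /iavg lebesgue_measure_ball; last exact: ltW.
have k2n : (2 / k == 0) = false by exact: gt_eqF.
rewrite inver mulrn_eq0 k2n /= muleA -EFinM.
rewrite (_ : 4 * B * _ = B * k)//.
by field; rewrite gt_eqF.
Qed.


(** At a Lebesgue point the mean deviation from [a x] over shrinking balls tends to [0], and it
    dominates the mollification error. *)
Lemma mollify_cvg a x : locally_integrable setT a -> lebesgue_pt a x ->
  (\int[mu]_t (a t * (dstep (n.+1%:R * t + - (n.+1%:R * x)) * n.+1%:R)))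
    @[n --> \oo] --> a x.
Proof.
move=> la ax; have [B B0 hB] := @derive1_smooth_step_bounded R.
have r0 : (2 / n.+1%:R : R) @[n --> \oo] --> (0 : R)^'+.
  have h : (2 / n.+1%:R : R) @[n --> \oo] --> (0 : R).
    rewrite -(mulr0 2); apply: cvgM; first exact: cvg_cst.
    exact: cvg_harmonic.
  move=> A A0.
  have : \forall n \near \oo, 0 < (2 / n.+1%:R : R) -> A (2 / n.+1%:R) := h _ A0.
  by apply: filterS => n; apply; exact: divr_gt0.
have /fine_cvgP[fd cd] : davg a x (2 / n.+1%:R) @[n --> \oo] --> 0%E.
  exact: (cvg_comp _ _ r0 ax).
apply/cvgrPdist_le => e e0.
have e4 : 0 < e / (4 * B) by rewrite divr_gt0// mulr_gt0.
move/cvgrPdist_le : cd => /(_ _ e4) cd.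
near=> n; rewrite distrC -lee_fin.
apply: le_trans (mollify_dist x (ltr0Sn R n) la hB) _.
have fn : davg a x (2 / n.+1%:R) \is a fin_num by near: n.
have : `|0 - fine (davg a x (2 / n.+1%:R))| <= e / (4 * B) by near: n.
rewrite sub0r normrN => dn.
rewrite -(fineK fn) -EFinM lee_fin mulrC -ler_pdivlMr ?mulr_gt0//.
exact: le_trans (ler_norm _) dn.
Unshelve. all: by end_near. Qed.

Lemma elementary_smooth_ramp k x : elementary_smooth (ramp k x).
Proof. by apply: es_affine; exact: elementary_smooth_step. Qed.

Lemma ramp_le k x t : 0 < k -> t <= x -> ramp k x t = 0.
Proof.
by move=> k0 tx; apply: smooth_step_le0; rewrite -mulrBr pmulr_rle0// subr_le0.
Qed.

Lemma ramp_ge k x t : 0 < k -> x + k^-1 <= t -> ramp k x t = 1.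
Proof.
move=> k0 xt; apply: smooth_step_ge1.
by rewrite -mulrBr mulrC -ler_pdivrMr// mul1r lerBrDl.
Qed.

(** A smooth approximation of the indicator of []x, y]]. Its derivative is the difference of the
    kernels at [x] and [y], so testing against it compares the values of a function at these two
    points. *)
Definition plateau k x y t : R := ramp k x t + -1 * ramp k y t.

Lemma plateau_out k x y t : 0 < k -> x <= y -> t \notin `[x, y + k^-1]%R ->
  plateau k x y t = 0.
Proof.
move=> k0 xy; rewrite in_itv/= negb_and -!ltNge /plateau => /orP[tx|yt].
  have tx' := ltW tx; have ty := le_trans tx' xy.
  by rewrite !ramp_le// mulr0 addr0.
have xt : x + k^-1 <= t by rewrite (le_trans _ (ltW yt))// lerD2r.
by rewrite !ramp_ge// ?ltW// mulN1r subrr.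
Qed.

Lemma test_function_plateau k x y : 0 < k -> x <= y ->
  test_function (plateau k x y).
Proof.
move=> k0 xy; split.
  move=> n t; apply: elementary_smooth_derivable; apply: es_add.
    exact: elementary_smooth_ramp.
  by apply: es_mul; [exact: es_cst|exact: elementary_smooth_ramp].
apply: (subclosed_compact _ (@segment_compact _ x (y + k^-1))).
  exact: closed_closure.
have /closure_id -> : closed `[x, y + k^-1]%classic.
  exact: interval_closed.
apply: closure_subset => t /= ; apply: contraNP => txy.
by rewrite plateau_out//; apply/negP.
Qed.

Lemma derive1_plateau k x y t : (plateau k x y)^`() t =
  dstep (k * t + - (k * x)) * k - dstep (k * t + - (k * y)) * k.
Proof.
rewrite derive1E; apply: derive_val.
apply: is_deriveD; first exact: is_derive_ramp.
apply: is_derive_eq; first by apply: is_deriveM; exact: is_derive_ramp.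
by rewrite /GRing.scale/=; ring.
Qed.

End DuBoisReymond.

Section WeakDerivative.
Variable R : realType.
Notation mu := (@lebesgue_measure R).
Implicit Types (a b f g : R -> R) (B k u v x y t : R).

(** The limit interval is half-open because a ramp vanishes at its own base point for every [n]: [x]
    is left out, while [y] is kept. *)
Lemma plateau_cvg x y t : x < y ->
  plateau n.+1%:R x y t @[n --> \oo] --> (\1_`]x, y] t : R).
Proof.
move=> xy.
have ramp_cvg z : ramp n.+1%:R z t @[n --> \oo] --> ((z < t)%R%:R : R).
  have [zt|zt] := ltP z t; last first.
    by under eq_fun do rewrite ramp_le//; exact: cvg_cst.
  apply: cvg_near_cst; near=> n; rewrite ramp_ge// -lerBrDl.
  rewrite invf_ple ?posrE ?subr_gt0//.
  near: n; exists (Num.truncn (t - z)^-1) => // n /= ln.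
  apply: (le_trans (ltW (truncnS_gt _))).
  by rewrite ler_nat ltnS.
have -> : \1_`]x, y] t = (x < t)%R%:R + -1 * (y < t)%R%:R :> R.
  rewrite indicE mem_setE in_itv/= leNgt.
  have [xt|xt] := ltP x t; first by case: (y < t); rewrite /=; ring.
  by rewrite [y < t]ltNge (le_trans xt (ltW xy))/=; ring.
apply: cvgD; first exact: ramp_cvg.
by apply: cvgM; [exact: cvg_cst|exact: ramp_cvg].
Unshelve. all: by end_near. Qed.

Lemma plateau_norm_le1 k x y t : `|plateau k x y t| <= 1.
Proof.
have /andP[h1 h2] := smooth_step_itv (k * t + - (k * x)).
have /andP[h3 h4] := smooth_step_itv (k * t + - (k * y)).
by rewrite /plateau /ramp ler_norml; lra.
Qed.

(** Dominated convergence with bound [|b|]: as [n.+1 >= 1], all the plateaus are supported in the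
    single interval [[x, y + 1]]. *)
Lemma plateau_Rintegral_cvg b x y : locally_integrable setT b -> x < y ->
  \int[mu]_t (b t * plateau n.+1%:R x y t) @[n --> \oo] -->
  \int[mu]_(t in `[x, y]) b t.
Proof.
move=> lb xy; have mb : measurable_fun setT b by case: lb.
have ib : mu.-integrable `[x, y + 1] (EFin \o b).
  exact: (@locally_integrable_itv _ _ `[x, y + 1]%R x (y + 1)).
have suppE n : \int[mu]_t (b t * plateau n.+1%:R x y t) =
    \int[mu]_(t in `[x, y + 1]) (b t * plateau n.+1%:R x y t).
  apply: Rintegral_support => t txy.
  rewrite plateau_out ?mulr0// ?ltW//.
  apply: contra txy; rewrite !in_itv/= => /andP[->/= h].
  by rewrite (le_trans h)// lerD2l invf_ple ?posrE// invr1 ler1n.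
have limE : \int[mu]_(t in `[x, y]) b t =
    \int[mu]_(t in `[x, y + 1]) (b t * \1_`]x, y] t).
  rewrite -Rintegral_itv_obnd_cbnd; last first.
    exact: (@locally_integrable_itv _ _ `]x, y]%R x y lb
      (@subset_itv_oc_cc _ _ _ _)).
  have E : `]x, y]%classic = `[x, y + 1] `&` `]x, y].
    apply/seteqP; split => t /=; rewrite !in_itv/=; last by case.
    move=> /andP[xt ty]; rewrite xt ty; split => //.
    by rewrite (ltW xt) (le_trans ty)// lerDl.
  rewrite [in LHS]E Rintegral_mkcondr; apply: eq_Rintegral => t _.
  rewrite patchE indicE.
  by case: ifPn => _ /=; rewrite ?mulr1 ?mulr0.
under eq_fun do rewrite suppE.
rewrite limE.
have mpl k : measurable_fun setT (plateau k x y).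
  apply: continuous_measurable_fun => t.
  apply: cvgD; first exact: continuous_ramp.
  by apply: cvgM; [exact: cvg_cst|exact: continuous_ramp].
have mbp n : measurable_fun setT (fun t => b t * plateau n.+1%:R x y t).
  exact: measurable_funM.
have mbi : measurable_fun setT (fun t => b t * \1_`]x, y] t).
  apply: measurable_funM => //; exact: measurable_indic.
have [] := @dominated_convergence _ _ _ mu `[x, y + 1]%classic
  (measurable_itv _) (fun n t => (b t * plateau n.+1%:R x y t)%:E)
  (fun t => (b t * \1_`]x, y] t)%:E) (fun t => `|b t|%:E).
- move=> n; apply/measurable_EFinP; apply: measurable_funTS; exact: mbp.
- by apply/measurable_EFinP; exact: measurable_funTS.
- apply: aeW => t _; apply/fine_cvgP; split; first exact: nearW.
  by apply: cvgM; [exact: cvg_cst|exact: plateau_cvg].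
- exact: integrable_norm.
- apply: aeW => t n _; rewrite lee_fin normrM ler_piMr//.
  exact: plateau_norm_le1.
move=> ilim _ cv; apply: fine_cvg.
rewrite fineK; last exact: integrable_fin_num.
exact: cv.
Qed.

(** Tested against a plateau, the weak identity equates the difference of the mollifications of [a]
    at [x] and [y] with minus the integral of [b] times the plateau. Both sides converge as the
    plateau sharpens. *)
Lemma weak_derivative_increment a b x y :
  locally_integrable setT a -> locally_integrable setT b ->
  weak_derivative a b -> lebesgue_pt a x -> lebesgue_pt a y -> x < y ->
  a y - a x = \int[mu]_(t in `[x, y]) b t.
Proof.
move=> la lb ab ax ay xy.
pose M n z := \int[mu]_t (a t * (dstep (n.+1%:R * t + - (n.+1%:R * z)) * n.+1%:R)).
have Mz n z : x <= z <= y -> M n z = \int[mu]_(t in `[x, y + n.+1%:R^-1])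
    (a t * (dstep (n.+1%:R * t + - (n.+1%:R * z)) * n.+1%:R)).
  move=> /andP[xz zy]; apply: Rintegral_support => t txy.
  rewrite dramp_out ?mulr0//.
  apply: contra txy; rewrite !in_itv/= => /andP[zt tz].
  by rewrite (le_trans xz)//= (le_trans tz)// lerD2r.
have iz n z : mu.-integrable `[x, y + n.+1%:R^-1]
    (EFin \o (fun t => a t * (dstep (n.+1%:R * t + - (n.+1%:R * z)) * n.+1%:R))).
  apply: (@locally_integrable_itv _ _ `[x, y + n.+1%:R^-1]%R x
    (y + n.+1%:R^-1)) => //.
  rewrite (_ : (fun t => _) = (fun t =>
      (dstep (n.+1%:R * t + - (n.+1%:R * z)) * n.+1%:R) * a t)).
    by apply: locally_integrable_mulr => //; exact: continuous_dramp.
  by apply/funext => t; rewrite mulrC.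
have ME n : M n x - M n y = - \int[mu]_t (b t * plateau n.+1%:R x y t).
  rewrite -(ab _ (test_function_plateau _ (ltW xy)))//.
  rewrite !Mz ?lexx ?ltW// -RintegralB//.
  rewrite [RHS](@Rintegral_support _ _ x (y + n.+1%:R^-1)).
    by apply: eq_Rintegral => t _; rewrite derive1_plateau mulrBr.
  move=> t txy; rewrite derive1_plateau !dramp_out ?subrr ?mulr0//.
    apply: contra txy; rewrite !in_itv/= => /andP[yt ->].
    by rewrite (le_trans _ yt)// ltW.
  apply: contra txy; rewrite !in_itv/= => /andP[-> tx]/=.
  by rewrite (le_trans tx)// lerD2r ltW.
have c1 : M n x - M n y @[n --> \oo] --> a x - a y.
  by apply: cvgB; exact: mollify_cvg.
have c2 : M n x - M n y @[n --> \oo] --> - \int[mu]_(t in `[x, y]) b t.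
  by under eq_fun do rewrite ME; apply: cvgN; exact: plateau_Rintegral_cvg.
have := cvg_unique _ c1 c2.
by move=> /(_ (@Rhausdorff R)) h; rewrite -[RHS]opprK -h opprB.
Qed.

(* Since integrals over [`[v, x]] are unsigned, the base point [v] has to lie to
   the left of the region of interest. *)
Lemma weak_derivative_primitive a b u :
  locally_integrable setT a -> locally_integrable setT b ->
  weak_derivative a b ->
  exists v c, v < u /\ {ae mu, forall x, v < x ->
    a x = c + \int[mu]_(t in `[v, x]) b t}.
Proof.
move=> la lb ab; have aeL := lebesgue_differentiation la.
have u1 : u - 1 < u by rewrite ltrBlDr ltrDl.
have [v /andP[_ vu] av] := ae_itvP aeL u1.
exists v, (a v); split => //.
move: aeL; apply: filterS; first exact: (ae_filter_ringOfSetsType mu).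
move=> x ax vx.
by rewrite -(weak_derivative_increment la lb ab av ax vx) addrC subrK.
Qed.

End WeakDerivative.

(** * Primitives of locally integrable functions *)

Section Primitive.
Variable R : realType.
Notation mu := (@lebesgue_measure R).
Implicit Types (b f h : R -> R) (c e l u v x y z t : R).

Lemma Rintegral_itvD b v x y : locally_integrable setT b -> v <= x -> x <= y ->
  \int[mu]_(t in `[v, y]) b t =
    \int[mu]_(t in `[v, x]) b t + \int[mu]_(t in `[x, y]) b t.
Proof.
move=> lb vx xy; apply/eqP; rewrite addrC -subr_eq; apply/eqP.
rewrite -[RHS]Rintegral_itv_obnd_cbnd.
  apply: Rintegral_itvB; rewrite ?bnd_simp//.
  exact: (@locally_integrable_itv _ _ `[v, y]%R v y).
exact: (@locally_integrable_itv _ _ `]x, y]%R x y lb (@subset_itv_oc_cc _ _ _ _)).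
Qed.

Lemma primitive_continuous b c v x : locally_integrable setT b -> v < x ->
  {for x, continuous (fun y => c + \int[mu]_(t in `[v, y]) b t)}.
Proof.
move=> lb vx.
have ib : mu.-integrable `[v, x + 1] (EFin \o b).
  exact: (@locally_integrable_itv _ _ `[v, x + 1]%R v (x + 1)).
have vx1 : v < x + 1 by rewrite (lt_trans vx)// ltrDl.
have /(continuous_within_itvP _ vx1)[ci _ _] :=
  parameterized_integral_continuous (ltW vx1) ib.
apply: cvgD; first exact: cvg_cst.
by apply: ci; rewrite in_itv/= vx ltrDl/=.
Qed.

Lemma Rintegral_near_cst b x y l e : x <= y -> locally_integrable setT b ->
  0 <= e -> {ae mu, forall t, x <= t <= y -> `|b t - l| <= e} ->
  `|\int[mu]_(t in `[x, y]) b t - l * (y - x)| <= e * (y - x).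
Proof.
move=> xy lb e0 ae_b.
have ib : mu.-integrable `[x, y] (EFin \o b).
  exact: (@locally_integrable_itv _ _ `[x, y]%R x y).
have ic : mu.-integrable `[x, y] (EFin \o (fun=> l)).
  apply: continuous_compact_integrable; first exact: segment_compact.
  by apply: continuous_subspaceT => t; exact: cvg_cst.
have muxy : mu `[x, y]%classic = (y - x)%:E.
  rewrite lebesgue_measure_itv/= lte_fin -EFinD.
  by case: ltP => // yx; rewrite (@le_anti _ _ x y) ?subrr// xy.
have <- : \int[mu]_(t in `[x, y]) l = l * (y - x).
  by rewrite Rintegral_cst// -[y - x in RHS]/(fine (y - x)%:E) -muxy.
rewrite -RintegralB// -lee_fin.
pose D t := b t - l.
have iD : mu.-integrable `[x, y] (EFin \o D).
  rewrite (_ : EFin \o D = (fun t => (b t)%:E - l%:E)%E)//.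
  exact: integrableB.
rewrite (@EFin_normr_Rintegral _ _ _ mu `[x, y] D)//.
have mD : measurable_fun (`[x, y]%classic : set R) (EFin \o D).
  by case/integrableP : iD.
apply: le_trans (le_abse_integral _ _ _) _ => //.
rewrite EFinM -muxy.
apply: integral_le_bound => //.
Qed.

(** The integrand is known only almost everywhere, so its values near [x] are read off a function
    [h] continuous at [x]; an increment of the primitive then differs from [h x * (y - x)] by at
    most [e * |y - x|]. *)
Lemma primitive_is_derive b h c v x r : locally_integrable setT b -> v < x ->
  0 < r -> {ae mu, forall t, `|t - x| < r -> b t = h t} ->
  {for x, continuous h} ->
  is_derive x (1 : R) (fun y => c + \int[mu]_(t in `[v, y]) b t) (h x).
Proof.
move=> lb vx r0 bh /cvgrPdist_le ch; apply: is_derive1_bound => e e0.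
have [d /= d0 hd] := ch _ e0.
(* [x - v] keeps [y] to the right of the base point, [r] is the range of the identity [b = h], and
   [d] comes from the continuity of [h]. *)
pose s := Num.min (x - v) (Num.min r d).
exists s; first by rewrite !lt_min subr_gt0 vx r0 d0.
move=> y; rewrite !lt_min => /and3P[yv yr yd].
have bnd z w : z <= w -> `|z - x| <= `|y - x| -> `|w - x| <= `|y - x| ->
    `|\int[mu]_(t in `[z, w]) b t - h x * (w - z)| <= e * (w - z).
  move=> zw zy wy; apply: Rintegral_near_cst => //; first exact: ltW.
  move: bh; apply: filterS; first exact: (ae_filter_ringOfSetsType mu).
  move=> t bt /andP[zt tw].
  have ty : `|t - x| <= `|y - x|.
    move: zy wy; rewrite !(ler_norml _ `|y - x|) => /andP[? ?] /andP[? ?].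
    by apply/andP; split; lra.
  rewrite bt ?(le_lt_trans ty)// distrC; apply: hd => /=.
  by rewrite distrC (le_lt_trans ty).
have [xy|yx] := leP x y.
- rewrite (Rintegral_itvD lb (ltW vx) xy).
  set A := \int[mu]_(t in `[v, x]) b t; set I := \int[mu]_(t in `[x, y]) b t.
  have -> : c + (A + I) - (c + A) - h x * (y - x) = I - h x * (y - x) by ring.
  rewrite (ger0_norm (_ : 0 <= y - x)) ?subr_ge0//.
  by apply: bnd => //; rewrite subrr normr0.
- have vy : v <= y.
    by move: yv; rewrite distrC gtr0_norm ?subr_gt0// => yv; lra.
  rewrite (Rintegral_itvD lb vy (ltW yx)).
  set A := \int[mu]_(t in `[v, y]) b t; set I := \int[mu]_(t in `[y, x]) b t.
  have -> : c + A - (c + (A + I)) - h x * (y - x) = - (I - h x * (x - y)) by ring.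
  rewrite normrN [X in _ <= _ * X]distrC (gtr0_norm (_ : 0 < x - y)) ?subr_gt0//.
  by apply: bnd; rewrite ?subrr ?normr0// ltW.
Qed.

(** By Lebesgue differentiation, [b] is almost everywhere the derivative of its primitive, here of a
    constant. *)
Lemma primitive_locally_cst b c v u w l : locally_integrable setT b ->
  v < u -> (forall x, u < x < w -> c + \int[mu]_(t in `[v, x]) b t = l) ->
  {ae mu, forall x, u < x < w -> b x = 0}.
Proof.
move=> lb vu hl; move: (lebesgue_differentiation lb).
apply: filterS; first exact: (ae_filter_ringOfSetsType mu).
move=> x bx /andP[ux xw].
have x1 : x < x + 1 by rewrite ltrDl.
have ib : mu.-integrable `[v, x + 1] (EFin \o b).
  exact: (@locally_integrable_itv _ _ `[v, x + 1]%R v (x + 1)).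
have [|_ <-] := FTC1_lebesgue_pt x1 ib _ bx.
  by rewrite lte_fin (lt_trans vu).
rewrite derive1E -(derive_cst (l - c) x (1 : R)).
apply: near_eq_derive; near=> y.
apply: (addrI c); rewrite /cst hl; first by rewrite addrC subrK.
by apply/andP; split; near: y; [exact: lt_nbhsr|exact: lt_nbhsl].
Unshelve. all: by end_near. Qed.

Lemma continuous_ae_cst h u w l :
  (forall x, u < x < w -> {for x, continuous h}) ->
  {ae mu, forall x, u < x < w -> h x = l} -> forall x, u < x < w -> h x = l.
Proof.
move=> ch hl x /[dup] uxw /andP[ux xw]; apply: contrapT => /eqP hx.
have dx : 0 < `|h x - l| by rewrite normr_gt0 subr_eq0.
have /cvgrPdist_lt/(_ _ dx)[d /= d0 hd] := ch x uxw.
have [|y] := ae_itvP (u := x) (v := Num.min w (x + d)) hl.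
  by rewrite lt_min xw ltrDl.
rewrite lt_min => /and3P[xy yw yd]; rewrite (lt_trans ux xy) yw => /(_ isT) hy.
have : ball_ Num.norm x d y by rewrite /= ltr_distlC; apply/andP; split; lra.
by move=> /hd /=; rewrite hy ltxx.
Qed.

(** If [h x < f x], monotonicity keeps [f] above [f x] to the right of [x], while continuity keeps
    [h] below it; the two then differ on an interval. The opposite inequality is excluded in the
    same way on the left. *)
Lemma nondecreasing_ae_eq f h v : {homo f : x y / x <= y} ->
  (forall x, v < x -> {for x, continuous h}) ->
  {ae mu, forall x, v < x -> f x = h x} ->
  forall x, v < x -> f x = h x.
Proof.
move=> ndf ch fh x vx; apply/eqP; rewrite eq_le; apply/andP; split.
- rewrite leNgt; apply/negP => hf.
  have [d /= d0 hd] := ch x vx _ (lt_nbhsl hf).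
  have [|y /andP[xy yd] fhy] := ae_itvP (u := x) (v := x + d) fh.
    by rewrite ltrDl.
  have /hd /= : ball_ Num.norm x d y.
    by rewrite /= ltr_distlC; apply/andP; split; lra.
  by rewrite -fhy ?(lt_trans vx)// ltNge ndf// ltW.
- rewrite leNgt; apply/negP => hf.
  have [d /= d0 hd] := ch x vx _ (lt_nbhsr hf).
  have [|y /andP[xy yd] fhy] := ae_itvP (u := Num.max v (x - d)) (v := x) fh.
    by rewrite gt_max vx ltrBlDr ltrDl.
  move: xy; rewrite gt_max => /andP[vy xdy].
  have /hd /= : ball_ Num.norm x d y.
    by rewrite /= ltr_distlC; apply/andP; split; lra.
  by rewrite -fhy// ltNge ndf// ltW.
Qed.

End Primitive.

(** * Decay of solutions *)

Section ExponentialDecay.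
Variable R : realType.
Implicit Types (D F W : R -> R) (x y : R).

Lemma ge0_is_derive_homo (f f' : R -> R) x y : x <= y ->
  (forall z, x <= z <= y -> is_derive z (1 : R) f (f' z)) ->
  (forall z, x <= z <= y -> 0 <= f' z) -> f x <= f y.
Proof.
move=> xy df f0.
have [||c /itvP cxy e] := MVT_segment xy (df := f') (f := f).
- by move=> z /itvP zxy; apply: df; rewrite !zxy.
- apply: derivable_within_continuous => z /itvP zxy.
  by apply: ex_derive; apply: df; rewrite !zxy.
by rewrite -subr_ge0 e mulr_ge0 ?f0 ?subr_ge0// !cxy.
Qed.

(* [alpha * W ^ 2 - (D / rr) ^ 2] is nondecreasing, and nonnegative at -oo because
   [D] vanishes there; hence [D' = F * W] dominates a multiple of [D]. *)
Lemma exponential_decay D F W (W' : R -> R) (rl rr alpha : R) :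
  0 < alpha -> 0 < rl -> (forall x, x < 0 -> rl <= F x <= rr) ->
  (forall x, x < 0 -> 0 <= W x) -> (forall x, x < 0 -> 0 <= D x) ->
  (forall x, x < 0 -> is_derive x (1 : R) D (F x * W x)) ->
  (forall x, x < 0 -> is_derive x (1 : R) W (W' x)) ->
  (forall x, x < 0 -> D x / F x <= alpha * W' x) ->
  D x @[x --> -oo] --> 0 ->
  forall x, x < 0 ->
    D x <= D (x / 2) * expR (rl / rr / 2 * x / Num.sqrt alpha).
Proof.
move=> al0 rl0 Fb W0 D0 dD dW W'b Dlim.
have rr0 : 0 < rr.
  have /andP[h1 h2] := Fb (-1) (ltrN10 _).
  by rewrite (lt_le_trans rl0)// (le_trans h1).
pose E x := alpha * W x ^+ 2 - (D x / rr) ^+ 2.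
have dE x : x < 0 -> is_derive x (1 : R) E
    (2 * alpha * W x * W' x - 2 * D x * F x * W x / rr ^+ 2).
  move=> x0; have h1 := dD x x0; have h2 := dW x x0.
  have -> : E = (fun x => alpha * (W x * W x) - rr ^- 2 * (D x * D x)).
    by apply/funext => y; rewrite /E; field; rewrite gt_eqF.
  apply: is_derive_eq; rewrite /GRing.scale/=.
  by field; rewrite gt_eqF.
have E'0 x : x < 0 -> 0 <= 2 * alpha * W x * W' x - 2 * D x * F x * W x / rr ^+ 2.
  move=> x0; have /andP[Fl Fr] := Fb x x0.
  have F0 := lt_le_trans rl0 Fl.
  (* The second summand is the slack in replacing [1 / F] by the smaller [F / rr ^+ 2]. *)
  have -> : 2 * alpha * W x * W' x - 2 * D x * F x * W x / rr ^+ 2 =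
     2 * W x * (alpha * W' x - D x / F x) +
     2 * W x * D x * (F x)^-1 * (1 - (F x / rr) ^+ 2).
    by field; rewrite !gt_eqF.
  apply: addr_ge0; first by rewrite !mulr_ge0 ?W0// subr_ge0 W'b.
  rewrite !mulr_ge0 ?W0 ?D0 ?invr_ge0 ?(ltW F0)// subr_ge0.
  have Frr : 0 <= F x / rr by rewrite divr_ge0// ltW.
  by rewrite expr_le1// ler_pdivrMr// mul1r.
have E0 x : x < 0 -> 0 <= E x.
  move=> x0; rewrite leNgt; apply/negP => Ex.
  (* If [E x < 0], monotonicity forces [(D y / rr) ^+ 2 >= - E x] for all [y <= x]. The threshold is
     the value of [D] that makes this an equality, and [D] falls below it near -oo. *)
  have eps0 : 0 < rr * Num.sqrt (- E x) by rewrite mulr_gt0// sqrtr_gt0 oppr_gt0.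
  have [M [_ hM]] : \forall y \near -oo, `|0 - D y| < rr * Num.sqrt (- E x).
    by move/cvgrPdist_lt : Dlim; exact.
  pose y := Num.min x (M - 1).
  have yx : y <= x by rewrite ge_min lexx.
  have yM : y < M by rewrite gt_min; apply/orP; right; lra.
  have y0 : y < 0 by exact: le_lt_trans x0.
  have Eyx : E y <= E x.
    apply: (ge0_is_derive_homo yx).
      by move=> z /andP[_ zx]; apply: dE; exact: le_lt_trans x0.
    by move=> z /andP[_ zx]; apply: E'0; exact: le_lt_trans x0.
  have := hM _ yM; rewrite sub0r normrN ger0_norm ?D0// => Dy.
  have : (D y / rr) ^+ 2 < - E x.
    rewrite -[ltRHS]sqr_sqrtr ?oppr_ge0 ?ltW// ltrXn2r ?nnegrE//
      ?divr_ge0 ?D0 ?sqrtr_ge0 ?ltW//.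
    by rewrite ltr_pdivrMr// mulrC.
  have : 0 <= alpha * W y ^+ 2 by rewrite mulr_ge0 ?sqr_ge0// ltW.
  by move: Eyx; rewrite {1}/E; lra.
have sa0 : 0 < Num.sqrt alpha by rewrite sqrtr_gt0.
(* [0 <= E] gives [D / rr <= sqrt alpha * W]; together with [rl <= F] this bounds [D' = F * W] below
   by [k * D]. *)
set k := rl / rr / Num.sqrt alpha.
have k0 : 0 < k by rewrite !divr_gt0.
have FW x : x < 0 -> k * D x <= F x * W x.
  move=> x0; have /andP[Fl Fr] := Fb x x0.
  have : D x / rr <= Num.sqrt alpha * W x.
    have Dr0 : 0 <= D x / rr by rewrite divr_ge0 ?D0// ltW.
    have aW0 : 0 <= Num.sqrt alpha * W x by rewrite mulr_ge0 ?W0// ltW.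
    rewrite -(@ler_pXn2r _ 2)//.
    rewrite [leRHS]exprMn sqr_sqrtr; last exact: ltW.
    by rewrite -subr_ge0; exact: E0.
  rewrite -ler_pdivrMl// => WD.
  apply: (@le_trans _ _ (rl * W x)); last by rewrite ler_wpM2r ?W0.
  rewrite (_ : k * D x = rl * ((Num.sqrt alpha)^-1 * (D x / rr))) ?ler_pM2l//.
  by rewrite /k; field; rewrite !gt_eqF.
move=> x x0.
have dexp z : is_derive z (1 : R) (fun z => expR (- k * z)) (- k * expR (- k * z)).
  rewrite mulrC; apply: (@is_derive1_comp _ expR (fun z => - k * z)).
  by apply: is_derive_eq; rewrite /GRing.scale/= mulr1.
(* [D z * expR (- k * z)] is compared between [x] and [x / 2], because nothing is assumed at [0].
   This costs the factor [1 / 2] in the rate. *)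
have x2 : x <= x / 2 by lra.
have zneg z : x <= z <= x / 2 -> z < 0 by move=> /andP[_ zx]; lra.
have : D x * expR (- k * x) <= D (x / 2) * expR (- k * (x / 2)).
  apply: (@ge0_is_derive_homo (fun z => D z * expR (- k * z))
    (fun z => (F z * W z - k * D z) * expR (- k * z)) x (x / 2) x2).
    move=> z /zneg z0; have h := dD z z0; have h' := dexp z.
    by apply: is_derive_eq; rewrite /GRing.scale/=; ring.
  by move=> z /zneg z0; rewrite mulr_ge0 ?expR_ge0// subr_ge0 FW.
rewrite -ler_pdivlMr ?expR_gt0//.
rewrite (_ : rl / rr / 2 * x / Num.sqrt alpha = - k * (x / 2) - - k * x).
  by rewrite expRB mulrA.
by rewrite /k; field; rewrite !gt_eqF.
Qed.

End ExponentialDecay.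

(** * Concavity and end values of the entropic pressure *)

Lemma below_tangent (R : realType) (f f' : R -> R) :
  (forall z : R, 0 < z -> is_derive z (1 : R) f (f' z)) ->
  (forall x y : R, 0 < x -> x < y -> f' y < f' x) ->
  forall r T : R, 0 < r -> 0 < T -> f T <= f r + f' r * (T - r).
Proof.
move=> df decr r T r0 T0.
have cf (u v : R) : 0 < u -> {within `[u, v], continuous f}.
  move=> u0; apply: derivable_within_continuous => z.
  rewrite in_itv/= => /andP[uz _].
  by apply: ex_derive; apply: df; exact: lt_le_trans uz.
have [rT|Tr|->] := ltgtP r T; last by rewrite subrr mulr0 addr0.
- have [|z /itvP zrT e] := MVT rT (f := f) (df := f') _ (cf _ _ r0).
    by move=> z /itvP zrT; apply: df; rewrite (lt_trans r0)// zrT.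
  rewrite -lerBlDl e ler_wpM2r ?subr_ge0 ?(ltW rT)//.
  by rewrite ltW// decr// zrT.
- have [|z /itvP zrT e] := MVT Tr (f := f) (df := f') _ (cf _ _ T0).
    by move=> z /itvP zrT; apply: df; rewrite (lt_trans T0)// zrT.
  rewrite -lerBlDl -(opprB (f r)) e -(opprB r T) mulrN lerN2.
  rewrite ler_wpM2r ?subr_ge0 ?(ltW Tr)// ltW//.
  by rewrite decr ?(lt_trans T0)// zrT.
Qed.

Section EntropicPressure.
Variables (R : realType) (d : shock_data R).
Implicit Types (s : state R) (r x y T : R).
Local Notation m := (mass_flux d).
Local Notation p := (reduced_pressure d).
Local Notation S := (entropic_pressure d).

Lemma velocity_dens s : 0 < dens s -> rankine_hugoniot d s ->
  velocity d (dens s) = vel s.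
Proof.
move=> s0 [mE _ _]; rewrite /velocity -mE.
by field; rewrite gt_eqF.
Qed.

(** Once the velocity is eliminated by the mass relation and both fluxes by the other two, this is
    an algebraic identity valid for any value [P] of the pressure. *)
Lemma int_energy_dens s : m != 0 -> 0 < dens s -> rankine_hugoniot d s ->
  int_energy d (dens s) = state_int_energy s.
Proof.
move=> m0 s0 /[dup] hs [h1 h2 h3].
have U : vel s = speed d + m / dens s by rewrite -(velocity_dens s0 hs).
rewrite /int_energy -h3 -h2.
move: (eos d _ _) => P.
by rewrite /state_int_energy U; field; rewrite m0 gt_eqF.
Qed.

Lemma entropic_pressure_dens s : m != 0 -> 0 < dens s ->
  rankine_hugoniot d s -> S (dens s) = 0.
Proof.
move=> m0 s0 /[dup] hs [h1 h2 h3].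
rewrite /entropic_pressure /reduced_pressure (int_energy_dens m0 s0 hs) -h2.
by rewrite -(velocity_dens s0 hs) /velocity; ring.
Qed.

Hypothesis pC2 : C2_pos p.

Lemma is_derive_entropic_pressure r : 0 < r ->
  is_derive r (1 : R) S (m ^+ 2 / r ^+ 2 - p^`()%classic r).
Proof.
move=> r0; have rn : r != 0 by rewrite gt_eqF.
have dp : is_derive r (1 : R) p (p^`()%classic r).
  by rewrite derive1E; apply: derivableP; have [] := pC2 r0.
have dV := is_derive1_inv rn.
rewrite /entropic_pressure; move: (p) dp => P dp.
by apply: is_derive_eq; rewrite /GRing.scale/=; field.
Qed.

Lemma derive1_entropic_pressure r : 0 < r ->
  S^`()%classic r = m ^+ 2 / r ^+ 2 - p^`()%classic r.
Proof.
move=> r0; rewrite [LHS]derive1E.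
by apply: derive_val; exact: is_derive_entropic_pressure.
Qed.

Lemma is_derive2_entropic_pressure r : 0 < r ->
  is_derive r (1 : R) S^`()%classic (- (2 * m ^+ 2 / r ^+ 3 + p^`(2)%classic r)).
Proof.
move=> r0; have rn : r != 0 by rewrite gt_eqF.
apply: (@near_eq_is_derive _ _ _
  (fun y : R => m ^+ 2 * (y^-1 * y^-1) - p^`()%classic y)).
  near=> y; rewrite derive1_entropic_pressure ?expr2 ?invfM//.
  by near: y; exact: lt_nbhsr.
have dp : is_derive r (1 : R) p^`()%classic (p^`(2)%classic r).
  have [_ dp1 _] := pC2 r0; move: (p) dp1 => P dp1.
  rewrite derive1nS derive1n1 [X in is_derive _ _ _ X]derive1E.
  exact: derivableP dp1.
have dV := is_derive1_inv rn.
move: (p^`()%classic) (p^`(2)%classic) dp => P P2 dp.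
by apply: is_derive_eq; rewrite /GRing.scale/=; field.
Unshelve. all: by end_near. Qed.

Lemma continuous_derive1_entropic_pressure r : 0 < r ->
  {for r, continuous S^`()}.
Proof.
by move=> /is_derive2_entropic_pressure H; exact: (is_derive1_continuous H).
Qed.

Hypothesis m0 : m != 0.
Hypothesis pconv : forall r, 0 < r -> 0 <= p^`(2)%classic r.

(** Strictness comes from the term [2 * m ^+ 2 / r ^+ 3] of -S'' alone, since p'' may vanish. *)
Lemma derive1_entropic_pressure_decr x y : 0 < x -> x < y ->
  S^`()%classic y < S^`()%classic x.
Proof.
move=> x0 xy.
have pos z : z \in `]x, y[%R -> 0 < z.
  by move=> /itvP zxy; rewrite (lt_trans x0)// zxy.
have [||z zxy e] := MVT xy (f := S^`()%classic)
    (df := fun r => - (2 * m ^+ 2 / r ^+ 3 + p^`(2)%classic r)).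
- by move=> z /pos; exact: is_derive2_entropic_pressure.
- apply: derivable_within_continuous => z; rewrite in_itv/= => /andP[xz _].
  apply: ex_derive; apply: is_derive2_entropic_pressure.
  exact: lt_le_trans xz.
have z0 := pos z zxy.
have m2 : 0 < 2 * m ^+ 2 / z ^+ 3.
  rewrite divr_gt0 ?exprn_gt0// mulr_gt0// lt_neqAle sqr_ge0 andbT.
  by rewrite eq_sym sqrf_eq0.
by rewrite -subr_lt0 e pmulr_llt0 ?subr_gt0// oppr_lt0 ltr_pwDl// pconv.
Qed.

End EntropicPressure.

(** * A single wave at fixed [alpha]: regularity, ODE and decay *)

Section TravelingWave.
Variable R : realType.
Notation mu := (@lebesgue_measure R).

Lemma continuous_locally_integrable (h : R -> R) : continuous h ->
  locally_integrable setT h.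
Proof.
move=> ch; split; [exact: continuous_measurable_fun|exact: openT|].
move=> K _ cK.
have /integrableP[] // : mu.-integrable K (EFin \o h).
by apply: continuous_compact_integrable => //; exact: continuous_subspaceT.
Qed.

(** Pointwise, [|h| <= 1 + h ^+ 2]. *)
Lemma L2loc_locally_integrable (h : R -> R) : L2loc h ->
  locally_integrable setT h.
Proof.
move=> [mh lh2].
have l1 : locally_integrable setT (fun=> 1 : R).
  by apply: continuous_locally_integrable => x; exact: cvg_cst.
have [mg _ lg] := locally_integrableD l1 lh2.
split; [exact: mh|exact: openT|move=> K KT cK].
apply: le_lt_trans (lg K KT cK).
have mK : measurable K by exact: compact_measurable.
apply: ge0_le_integral => //.
- apply/measurable_EFinP; apply: measurable_funTS.
  exact: measurableT_comp.
- apply/measurable_EFinP; apply: measurable_funTS.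
  exact: measurableT_comp.
- move=> x _; rewrite lee_fin /= [leRHS]ger0_norm ?addr_ge0 ?sqr_ge0//.
  by rewrite -[h x ^+ 2]real_normK ?num_real//; nra.
Qed.

(* [s], [s1] and [p2] stand for S, S' and p''. *)
Variables (s s1 p2 : R -> R) (m alpha Rl Rr Rs : R) (f g : R -> R).
Hypothesis alpha0 : 0 < alpha.
Hypothesis Rl0 : 0 < Rl.
Hypothesis ds : forall r : R, 0 < r -> is_derive r (1 : R) s (s1 r).
Hypothesis ds1 : forall r : R, 0 < r ->
  is_derive r (1 : R) s1 (- (2 * m ^+ 2 / r ^+ 3 + p2 r)).
Hypothesis s1_decr : forall x y : R, 0 < x -> x < y -> s1 y < s1 x.
Hypothesis s1Rs : s1 Rs = 0.
Hypothesis p2_ge0 : forall r : R, 0 < r -> 0 <= p2 r.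
Hypothesis sRl : s Rl = 0.
Hypothesis sRr : s Rr = 0.
Hypothesis RlRs : Rl < Rs.
Hypothesis RsRr : Rs < Rr.
Hypothesis f_homo : {homo f : x y / x <= y}.
Hypothesis f_itv : forall x, Rl <= f x <= Rr.
Hypothesis f0 : f 0 = Rs.
Hypothesis fg : W12loc f g.

Let flux x := alpha * (s1 (f x) / f x) * g x.
Let source x := s (f x) / f x - 2 * alpha * (m ^+ 2 / f x ^+ 4) * g x ^+ 2.
Hypothesis flux_source : weak_derivative flux source.

Let f_gt0 x : 0 < f x.
Proof. by have /andP[h _] := f_itv x; exact: lt_le_trans h. Qed.

Let lg : locally_integrable setT g.
Proof. by have [_ /L2loc_locally_integrable] := fg. Qed.

(** Monotonicity removes the exceptional null set, so [f] itself, and not just a version of it, is a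
    primitive of [g]. *)
Lemma wave_primitive u : exists v c, v < u /\
  forall x, v < x -> f x = c + \int[mu]_(t in `[v, x]) g t.
Proof.
have [lf _ wfg] := fg.
have [v [c [vu fE]]] :=
  weak_derivative_primitive u (L2loc_locally_integrable lf) lg wfg.
exists v, c; split => //; apply: (nondecreasing_ae_eq f_homo _ fE).
by move=> x vx; exact: primitive_continuous.
Qed.

Lemma wave_continuous : continuous f.
Proof.
move=> x; have [v [c [vx fE]]] := wave_primitive x.
have cP := @primitive_continuous R g c v x lg vx.
rewrite /continuous_at (fE x vx).
apply: cvg_trans cP; apply: near_eq_cvg; near=> y.
by rewrite fE//; near: y; exact: lt_nbhsr.
Unshelve. all: by end_near. Qed.

Let continuous_comp_wave (h : R -> R) :
  (forall r : R, 0 < r -> {for r, continuous h}) -> continuous (h \o f).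
Proof.
move=> ch x; apply: continuous_comp; first exact: wave_continuous.
exact: ch.
Qed.

Let cflux : continuous (fun x => alpha * (s1 (f x) / f x)).
Proof.
move=> x; apply: cvgM; first exact: cvg_cst.
apply: (@continuous_comp_wave (fun r => s1 r / r)) => r r0.
apply: cvgM; first exact: is_derive1_continuous (ds1 r0).
exact: (@continuous_exprnV R 1).
Qed.

Let csource1 : continuous (fun x => s (f x) / f x).
Proof.
apply: (@continuous_comp_wave (fun r => s r / r)) => r r0.
apply: cvgM; first exact: is_derive1_continuous (ds r0).
exact: (@continuous_exprnV R 1).
Qed.

Let csource2 : continuous (fun x => 2 * alpha * (m ^+ 2 / f x ^+ 4)).
Proof.
move=> x; apply: cvgM; first exact: cvg_cst.
apply: cvgM; first exact: cvg_cst.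
by apply: (@continuous_comp_wave (fun r => r ^- 4)) => r r0; exact: continuous_exprnV.
Qed.

Let lflux : locally_integrable setT flux.
Proof. exact: locally_integrable_mulr. Qed.

Let lsource : locally_integrable setT source.
Proof.
apply: (@locally_integrableB _ _ (fun x => s (f x) / f x)).
  exact: continuous_locally_integrable.
apply: locally_integrable_mulr => //.
by have [_ []] := fg.
Qed.

Lemma s1_gt0 (r : R) : 0 < r -> r < Rs -> 0 < s1 r.
Proof. by move=> r0 rRs; rewrite -s1Rs s1_decr. Qed.

Lemma s1_lt0 (r : R) : Rs < r -> s1 r < 0.
Proof. by move=> Rsr; rewrite -s1Rs s1_decr// (lt_trans Rl0). Qed.

Lemma s1_neq0 (r : R) : 0 < r -> r != Rs -> s1 r != 0.
Proof.
move=> r0; rewrite neq_lt => /orP[rRs|Rsr].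
  by rewrite gt_eqF// s1_gt0.
by rewrite lt_eqF// s1_lt0.
Qed.

Lemma s_ge_chord (r T : R) : 0 < r -> 0 < T -> s T = 0 -> s1 r * (r - T) <= s r.
Proof.
move=> r0 T0 sT; have := below_tangent ds s1_decr r0 T0.
by rewrite sT -lerBlDr sub0r -mulrN opprB.
Qed.

Lemma s_Rs_gt0 : 0 < s Rs.
Proof.
(* Any density strictly between [Rl] and [Rs] would do: the chord bound is strict there, and [s] is
   largest at [Rs], where its tangent is horizontal. *)
pose r := (Rl + Rs) / 2.
have rl : Rl < r by rewrite /r; have := RlRs; lra.
have rR : r < Rs by rewrite /r; have := RlRs; lra.
have r0 : 0 < r := lt_trans Rl0 rl.
have sr : 0 < s r.
  apply: lt_le_trans (s_ge_chord r0 Rl0 sRl).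
  by rewrite mulr_gt0 ?subr_gt0// s1_gt0.
apply: lt_le_trans sr _.
have := below_tangent ds s1_decr (lt_trans r0 rR) r0.
by rewrite s1Rs mul0r addr0.
Qed.

(* On a sonic plateau the flux vanishes, hence so does the source, which there
   reduces to [s Rs / Rs > 0]. *)
Lemma wave_no_plateau u w : u < w -> (forall x, u < x < w -> f x = Rs) -> False.
Proof.
move=> uw fRs.
have [v [c [vu fluxE]]] := weak_derivative_primitive u lflux lsource flux_source.
have [v' [c' [vu' fE]]] := wave_primitive u.
(* This primitive agrees with the vanishing flux only almost everywhere; its continuity extends the
   identity to the whole plateau. *)
have AE x : u < x < w -> c + \int[mu]_(t in `[v, x]) source t = 0.
  move: x; apply: (@continuous_ae_cst R
      (fun x => c + \int[mu]_(t in `[v, x]) source t) u w 0).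
    move=> x /andP[ux _]; apply: primitive_continuous => //.
    exact: lt_trans ux.
  move: fluxE; apply: filterS; first exact: (ae_filter_ringOfSetsType mu).
  move=> x h uxw; have /andP[ux _] := uxw.
  rewrite -h ?(lt_trans vu)// /flux fRs// s1Rs.
  by rewrite mul0r mulr0 mul0r.
have s0 := primitive_locally_cst lsource vu AE.
have g0 : {ae mu, forall x, u < x < w -> g x = 0}.
  apply: (@primitive_locally_cst R g c' v' u w Rs lg vu') => x uxw.
  by have /andP[ux _] := uxw; rewrite -fE ?(lt_trans vu')// fRs.
have h : {ae mu, forall x, u < x < w -> False}.
  move: s0 g0; apply: filterS2; first exact: (ae_filter_ringOfSetsType mu).
  move=> x sx gx uxw; have := sx uxw; rewrite /source gx// fRs//.
  rewrite expr0n/= mulr0 subr0 => /eqP; rewrite mulf_eq0 invr_eq0.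
  have Rs0 : 0 < Rs by exact: lt_trans RlRs.
  by rewrite !gt_eqF// s_Rs_gt0.
by have [x xuw /(_ xuw)] := ae_itvP h uw.
Qed.

Lemma wave_lt x : x < 0 -> f x < Rs.
Proof.
move=> x0; rewrite lt_neqAle -f0 f_homo ?ltW// andbT f0.
apply/eqP => fx; apply: (wave_no_plateau x0) => y /andP[xy y0].
by apply/le_anti/andP; split; [rewrite -f0|rewrite -fx]; rewrite f_homo ?ltW.
Qed.

Lemma wave_gt x : 0 < x -> Rs < f x.
Proof.
move=> x0; rewrite lt_neqAle -f0 f_homo ?ltW// andbT f0.
apply/eqP => fx; apply: (wave_no_plateau x0) => y /andP[y0 yx].
by apply/le_anti/andP; split; [rewrite fx|rewrite -f0]; rewrite f_homo ?ltW.
Qed.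

(** Taken from the classical derivative, because [g] is determined only almost everywhere. Its value
    is used only away from the sonic density. *)
Definition log_slope x : R := f^`()%classic x / f x.

(* Expanding the derivative of the flux [alpha * s1 f * w], the terms in
   [m ^+ 2] of S'' and of the source cancel, leaving only p''. *)
Lemma wave_ode x : f x != Rs ->
  is_derive x (1 : R) f (f x * log_slope x) /\
  exists2 w', is_derive x (1 : R) log_slope w' &
    alpha * s1 (f x) * w' =
      s (f x) / f x + alpha * p2 (f x) * f x * log_slope x ^+ 2.
Proof.
move=> fx.
have [v [c [vx fluxE]]] := weak_derivative_primitive x lflux lsource flux_source.
have [v' [c' [vx' fE]]] := wave_primitive x.
(* [A] is the continuous representative of the flux. Solving [flux = A] for [g] gives [H], which is
   continuous wherever [s1 (f y)] is nonzero. *)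
pose A y := c + \int[mu]_(t in `[v, y]) source t.
pose H y := f y * A y / (alpha * s1 (f y)).
have [r r0 near_x] : exists2 r, 0 < r & forall y, `|y - x| < r ->
    [/\ f y != Rs, v < y & v' < y].
  have : \forall y \near x, [/\ f y != Rs, v < y & v' < y].
    near=> y; split; near: y; [|exact: lt_nbhsr|exact: lt_nbhsr].
    have /cvgrPdist_lt/(_ `|f x - Rs|) := @wave_continuous x.
    rewrite normr_gt0 subr_eq0 => /(_ fx); apply: filterS => y.
    by apply: contraTneq => ->; rewrite ltxx.
  move=> [r /= r0 hr]; exists r => // y yr; apply: hr => /=.
  by rewrite distrC.
have s1f y : `|y - x| < r -> s1 (f y) != 0.
  by move=> /near_x[fy _ _]; exact: s1_neq0.
have cA y : v < y -> {for y, continuous A} by exact: primitive_continuous.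
have cH y : `|y - x| < r -> {for y, continuous H}.
  move=> yr; have [_ vy _] := near_x y yr.
  apply: cvgM; first by apply: cvgM; [exact: wave_continuous|exact: cA].
  apply: cvgV; first by rewrite mulf_neq0 ?s1f// gt_eqF.
  apply: cvgM; first exact: cvg_cst.
  by apply: continuous_comp_wave => z z0; exact: is_derive1_continuous (ds1 z0).
have gH : {ae mu, forall y, `|y - x| < r -> g y = H y}.
  move: fluxE; apply: filterS; first exact: (ae_filter_ringOfSetsType mu).
  move=> y h yr; have [_ vy _] := near_x y yr.
  rewrite /H /A -h// /flux; field.
  by rewrite s1f// !gt_eqF.
(* [f] is a primitive of [g], and [g] has the continuous representative [H]; hence [f] is
   classically differentiable. *)
have df y : `|y - x| < r -> is_derive y (1 : R) f (H y).
  move=> yr; have [_ _ vy'] := near_x y yr.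
  apply: (@near_eq_is_derive _ _ _ (fun y => c' + \int[mu]_(t in `[v', y]) g t)).
    by near=> z; rewrite -fE//; near: z; exact: lt_nbhsr.
  apply: (@primitive_is_derive R g H c' v' y (r - `|y - x|)) => //.
  - by rewrite subr_gt0.
  - move: gH; apply: filterS; first exact: (ae_filter_ringOfSetsType mu).
    move=> t ht ty; apply: ht.
    rewrite (le_lt_trans (ler_distD y _ _))//.
    by move: ty; rewrite ltrBrDr.
  - exact: cH.
have xr : `|x - x| < r by rewrite subrr normr0.
have wE y : `|y - x| < r -> log_slope y = A y / (alpha * s1 (f y)).
  move=> yr; rewrite /log_slope derive1E (@derive_val _ _ _ _ _ _ _ (df y yr)) /H.
  by field; rewrite s1f// !gt_eqF.
have HE : H x = f x * log_slope x by rewrite wE// /H mulrA.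
split; first by rewrite -HE; exact: df.
have [_ vxx _] := near_x x xr.
(* The source with [g] replaced by [H]: a continuous representative, so that [A] is differentiable
   in turn. *)
pose b y := s (f y) / f y - 2 * alpha * (m ^+ 2 / f y ^+ 4) * H y ^+ 2.
have dA : is_derive x (1 : R) A (b x).
  apply: (@primitive_is_derive R source b c v x r) => //.
    move: gH; apply: filterS; first exact: (ae_filter_ringOfSetsType mu).
    by move=> t ht tr; rewrite /source /b ht.
  apply: cvgB; first exact: csource1.
  apply: cvgM; first exact: csource2.
  by apply: cvgM; exact: cH.
have ds1f : is_derive x (1 : R) (s1 \o f)
    (- (2 * m ^+ 2 / f x ^+ 3 + p2 (f x)) * H x).
  by apply: is_derive1_comp; [exact: ds1|exact: df].
have s1n : alpha * (s1 \o f) x != 0 by rewrite mulf_neq0 ?s1f// gt_eqF.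
have dN : is_derive x (1 : R) (fun y => alpha * (s1 \o f) y)
    (alpha * (- (2 * m ^+ 2 / f x ^+ 3 + p2 (f x)) * H x)).
  by apply: is_derive_eq; rewrite /GRing.scale/=; ring.
have dW := is_deriveM dA (@is_deriveV _ (fun y => alpha * (s1 \o f) y) _ _ _ s1n dN).
have slopeE : \forall y \near x,
    (A * (fun y => (alpha * (s1 \o f) y)^-1)) y = log_slope y.
  by exists r => // y /=; rewrite distrC => yr; rewrite wE.
eexists; first exact: near_eq_is_derive slopeE dW.
rewrite /GRing.scale /=.
rewrite wE// /b /H /=; field.
by rewrite s1f// !gt_eqF.
Unshelve. all: by end_near. Qed.

Hypothesis fNy : f x @[x --> -oo] --> Rl.
Hypothesis fy : f x @[x --> +oo] --> Rr.

Let f_neq x : x != 0 -> f x != Rs.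
Proof.
rewrite neq_lt => /orP[/wave_lt h|/wave_gt h]; first by rewrite lt_eqF.
by rewrite gt_eqF.
Qed.

Let df x : x != 0 -> is_derive x (1 : R) f (f x * log_slope x).
Proof. by move=> /f_neq /wave_ode[]. Qed.

Let dlog_slope x : x != 0 ->
  is_derive x (1 : R) log_slope (log_slope^`()%classic x).
Proof.
move=> /f_neq /wave_ode[_ [w' dw _]].
by rewrite derive1E; apply: derivableP; exact: ex_derive.
Qed.

Lemma log_slope_ge0 x : x != 0 -> 0 <= log_slope x.
Proof.
move=> /df dfx; rewrite -(pmulr_rge0 _ (f_gt0 x)) -(@derive_val _ _ _ _ _ _ _ dfx).
have [cvf _] := dfx.
apply: limr_ge; first exact: cvf.
near=> h.
have h0 : h != 0 by near: h; exact: nbhs_dnbhs_neq.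
rewrite /GRing.scale/= mulr1; move: h0; rewrite neq_lt => /orP[h0|h0].
  by rewrite nmulr_rge0 ?invr_lt0// subr_le0 f_homo//; lra.
by rewrite pmulr_rge0 ?invr_gt0// subr_ge0 f_homo//; lra.
Unshelve. all: by end_near. Qed.

(** The factor [s1 (f x)] is kept because its sign differs on the two sides of the shock: dividing
    by it gives a lower bound on the slope's derivative on the left and an upper bound on the
    right. *)
Lemma log_slope_derive_bound x T : x != 0 -> 0 < T -> s T = 0 ->
  0 <= s1 (f x) * (alpha * log_slope^`()%classic x - (f x - T) / f x).
Proof.
move=> x0 T0 sT; have [_ [w' dw e]] := wave_ode (f_neq x0).
rewrite derive1E (@derive_val _ _ _ _ _ _ _ dw).
rewrite mulrBr mulrCA mulrA e subr_ge0 mulrA.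
apply: (@le_trans _ _ (s (f x) / f x)).
  by rewrite ler_wpM2r ?invr_ge0 ?(ltW (f_gt0 x))//; exact: s_ge_chord.
rewrite lerDl mulr_ge0 ?sqr_ge0// mulr_ge0 ?(ltW (f_gt0 x))//.
by rewrite mulr_ge0 ?p2_ge0// ltW.
Qed.

Lemma wave_decay_left x : x < 0 ->
  `|f x - Rl| <= (Rs - Rl) * expR (- (Rl / Rr / 2 * `|x|) / Num.sqrt alpha).
Proof.
move=> x0; have neg (y : R) : y < 0 -> y != 0 by move=> y0; rewrite lt_eqF.
have D0 y : 0 <= f y - Rl by rewrite subr_ge0; have /andP[] := f_itv y.
rewrite ger0_norm// (ltr0_norm x0) mulrN opprK.
have := @exponential_decay R (fun x => f x - Rl) f log_slope (log_slope^`()%classic)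
  Rl Rr alpha alpha0 Rl0.
move=> /(_ _ _ _ _ _ _ _ x x0) h; apply: le_trans (h _ _ _ _ _ _ _) _.
- by move=> y _; exact: f_itv.
- by move=> y /neg; exact: log_slope_ge0.
- by move=> y _; exact: D0.
- move=> y /neg y0; rewrite -[_ * _]subr0.
  by apply: is_deriveB; exact: df.
- by move=> y /neg; exact: dlog_slope.
- move=> y y0; have := log_slope_derive_bound (neg y y0) Rl0 sRl.
  by rewrite pmulr_rge0 ?subr_ge0// s1_gt0// wave_lt.
- by rewrite -(subrr Rl); apply: cvgB => //; exact: cvg_cst.
rewrite ler_wpM2r ?expR_ge0// lerD2r ltW// wave_lt//; lra.
Qed.

(** Reduced to the left half-line by reflection. For [D y = Rr - f (- y)] the two sign changes
    cancel in the derivative, which is again [F * W]; the sign gained by the derivative of [W]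
    matches the negative sign of [s1] beyond [Rs]. *)
Lemma wave_decay_right x : 0 < x ->
  `|f x - Rr| <= (Rr - Rs) * expR (- (Rl / Rr / 2 * `|x|) / Num.sqrt alpha).
Proof.
move=> x0; have pos (y : R) : y < 0 -> - y != 0.
  by move=> y0; rewrite oppr_eq0 lt_eqF.
have Rr0 : 0 < Rr by rewrite (lt_trans Rl0)// (lt_trans RlRs).
have D0 y : 0 <= Rr - f y by rewrite subr_ge0; have /andP[] := f_itv y.
rewrite distrC ger0_norm// (gtr0_norm x0) -mulrN -{1}[x]opprK.
have dN (y : R) : is_derive y (1 : R) (fun z : R => - z) (-1).
  by apply: is_derive_eq.
have nx0 : - x < 0 by rewrite oppr_lt0.
have := @exponential_decay R (fun x => Rr - f (- x)) (fun x => f (- x))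
  (fun x => log_slope (- x)) (fun x => - log_slope^`()%classic (- x))
  Rl Rr alpha alpha0 Rl0.
move=> /(_ _ _ _ _ _ _ _ (- x) nx0) h; apply: le_trans (h _ _ _ _ _ _ _) _.
- by move=> y _; exact: f_itv.
- by move=> y /pos; exact: log_slope_ge0.
- by move=> y _; exact: D0.
- move=> y /pos y0; have dfN := is_derive1_comp (df y0) (dN y).
  rewrite (_ : _ * _ = 0 - f (- y) * log_slope (- y) * -1); last by ring.
  exact: is_deriveB.
- move=> y /pos y0; rewrite -mulrN1.
  exact: is_derive1_comp (dlog_slope y0) (dN y).
- move=> y y0; have := log_slope_derive_bound (pos y y0) Rr0 sRr.
  rewrite nmulr_rge0; last by rewrite s1_lt0// wave_gt// oppr_gt0.
  by rewrite subr_le0 mulrN lerNr -mulNr opprB.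
- rewrite -(subrr Rr); apply: cvgB; first exact: cvg_cst.
  exact: (cvgy_compNP _ _).1 fy.
rewrite ler_wpM2r ?expR_ge0// lerD2l lerN2 ltW// wave_gt//; lra.
Qed.

End TravelingWave.

(** * Convergence to a step *)

Section StepConvergence.
Variable R : realType.
Implicit Types (F : R -> R -> R) (V : R -> R) (l r C k : R).

(** From exp(u) >= u. The resulting bound by a multiple of sqrt alpha suffices for pointwise
    convergence. *)
Lemma expRN_sqrt_bound C k (alpha : R) : 0 < k -> 0 < alpha -> 0 <= C ->
  C * expR (- k / Num.sqrt alpha) <= C / k * Num.sqrt alpha.
Proof.
move=> k0 a0 C0; rewrite -mulrA ler_wpM2l// mulNr expRN.
have sa0 : 0 < Num.sqrt alpha by rewrite sqrtr_gt0.
have ka0 : 0 < k / Num.sqrt alpha by rewrite divr_gt0.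
rewrite (_ : k^-1 * Num.sqrt alpha = (k / Num.sqrt alpha)^-1); last first.
  by rewrite invf_div mulrC.
rewrite lef_pV2 ?posrE ?expR_gt0//.
by apply: le_trans (expR_ge1Dx _); rewrite lerDr.
Qed.

Lemma decay_cvg_step F l r C k : 0 < C -> 0 < k ->
  (forall alpha xi : R, 0 < alpha -> xi != 0 ->
    `|F alpha xi - step l r xi| <= C * expR (- (k * `|xi|) / Num.sqrt alpha)) ->
  cvg_step F l r.
Proof.
move=> C0 k0 decay; split=> [xi xi0|K cK K0].
- have kx0 : 0 < k * `|xi| by rewrite mulr_gt0// normr_gt0.
  have Ck0 : 0 < C / (k * `|xi|) by rewrite divr_gt0.
  apply/cvgrPdist_le => e e0.
  have ee : 0 < e / (C / (k * `|xi|)) by rewrite divr_gt0.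
  near=> alpha.
  have a0 : 0 < alpha by near: alpha; exact: nbhs_right_gt.
  rewrite distrC; apply: le_trans (decay _ _ a0 xi0) _.
  apply: le_trans (expRN_sqrt_bound kx0 a0 (ltW C0)) _.
  rewrite mulrC -ler_pdivlMr//.
  rewrite -[leRHS]ger0_norm ?(ltW ee)// -sqrtr_sqr ler_sqrt ?sqr_ge0//.
  by near: alpha; apply: nbhs_right_le; exact: (exprn_gt0 2 ee).
(* A compact set avoiding [0] stays at some distance [e] from it, which gives the rate [k * e]. The
   decay holds for every positive [alpha], so the threshold [1] is arbitrary. *)
- have nK0 : ~ K 0 by move=> /K0[]/=; rewrite ltxx.
  have oK : open (~` K) by apply: closed_openC; exact: compact_closed.
  have [e /= e0 eK] := open_nbhs_nbhs (conj oK (nK0 : (~` K) (0 : R))).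
  exists C, (k * e), 1; split => //; first exact: mulr_gt0.
  move=> alpha /andP[a0 _] xi Kxi.
  have xi0 : xi != 0 by apply/eqP => x0; apply: nK0; rewrite -x0.
  have exi : e <= `|xi|.
    by rewrite leNgt; apply/negP => xe; apply: (eK xi) => //=; rewrite sub0r normrN.
  apply: le_trans (decay _ _ a0 xi0) _.
  rewrite ler_pM2l// ler_expR !mulNr lerN2 ler_pM2r ?invr_gt0 ?sqrtr_gt0//.
  by rewrite ler_pM2l.
Unshelve. all: by end_near. Qed.

Lemma C1_lipschitz_itv V (V' : R -> R) (a b : R) : 0 < a -> a <= b ->
  (forall z : R, 0 < z -> is_derive z (1 : R) V (V' z)) ->
  (forall z : R, 0 < z -> {for z, continuous V'}) ->
  exists2 L, 0 < L & forall x y, a <= x <= b -> a <= y <= b ->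
    `|V x - V y| <= L * `|x - y|.
Proof.
move=> a0 ab dV cV'.
have [|c cab hc] := @EVT_max _ (fun z => `|V' z|) a b ab.
  apply: continuous_in_subspaceT => z; rewrite inE/= in_itv/= => /andP[az _].
  by apply: cvg_norm; apply: cV'; exact: lt_le_trans az.
(* The [+ 1] keeps the constant positive when [V'] vanishes on the whole interval. *)
exists (`|V' c| + 1); first by rewrite ltr_wpDl.
have main x y : a <= x -> x <= y -> y <= b ->
    `|V y - V x| <= (`|V' c| + 1) * `|y - x|.
  move=> ax xy yb.
  have [||z zxy ->] := MVT_segment xy (f := V) (df := V').
  - move=> z; rewrite in_itv/= => /andP[xz _]; apply: dV.
    by rewrite (lt_le_trans a0)// (le_trans ax)// ltW.
  - apply: derivable_within_continuous => z; rewrite in_itv/= => /andP[xz _].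
    apply: ex_derive; apply: dV.
    by rewrite (lt_le_trans a0)// (le_trans ax).
  rewrite normrM ler_wpM2r// (@le_trans _ _ `|V' c|) ?lerDl//; apply: hc.
  move: zxy; rewrite !in_itv/= => /andP[xz zy].
  by rewrite (le_trans ax)//= (le_trans zy).
move=> x y /andP[ax xb] /andP[ay yb]; have [xy|yx] := leP x y.
  by rewrite distrC (distrC x); exact: main.
by apply: main => //; exact: ltW.
Qed.

(** Profile and step both take values in [[a, b]], where [V] is Lipschitz; composing multiplies [C]
    by the Lipschitz constant and preserves the rate. *)
Lemma decay_cvg_step_comp F V (V' : R -> R) (a b C k : R) :
  0 < a -> a <= b -> 0 < C -> 0 < k ->
  (forall alpha xi : R, 0 < alpha -> a <= F alpha xi <= b) ->
  (forall alpha xi : R, 0 < alpha -> xi != 0 ->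
    `|F alpha xi - step a b xi| <= C * expR (- (k * `|xi|) / Num.sqrt alpha)) ->
  (forall z : R, 0 < z -> is_derive z (1 : R) V (V' z)) ->
  (forall z : R, 0 < z -> {for z, continuous V'}) ->
  cvg_step (fun alpha xi => V (F alpha xi)) (V a) (V b).
Proof.
move=> a0 ab C0 k0 Fab decay dV cV'.
have [L L0 VL] := C1_lipschitz_itv a0 ab dV cV'.
apply: (@decay_cvg_step _ _ _ (L * C) k) => // [|alpha xi al0 xi0].
  exact: mulr_gt0.
have -> : step (V a) (V b) xi = V (step a b xi) by rewrite /step; case: ifP.
apply: (le_trans (VL _ _ _ _)); first exact: Fab.
  by rewrite /step; case: ifP => _; rewrite ?lexx ?ab.
by rewrite -mulrA ler_pM2l//; exact: decay.
Qed.

End StepConvergence.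

(** * Derivatives of velocity and internal energy with respect to density *)

Section DensityFunctions.
Variables (R : realType) (d : shock_data R).
Local Notation m := (mass_flux d).

Lemma is_derive_velocity (r : R) : 0 < r ->
  is_derive r (1 : R) (velocity d) (- m * r ^- 2).
Proof.
move=> r0; have rn : r != 0 by rewrite gt_eqF.
have dV := is_derive1_inv rn.
by apply: is_derive_eq; rewrite /GRing.scale/=; field.
Qed.

Lemma is_derive_int_energy (r : R) : 0 < r ->
  is_derive r (1 : R) (int_energy d)
    (- (m * speed d - mom_flux d) * r ^- 2 - m ^+ 2 * r ^- 3).
Proof.
move=> r0; have rn : r != 0 by rewrite gt_eqF.
have dV := is_derive1_inv rn.
have -> : int_energy d = fun y =>
    ((ener_flux d - mom_flux d * speed d + m / 2 * speed d ^+ 2) / m) +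
    (m * speed d - mom_flux d) * y^-1 + m ^+ 2 / 2 * (y^-1 * y^-1).
  apply/funext => y; rewrite /int_energy; congr (_ + _).
  by rewrite invfM -expr2 exprVn mulrA.
by apply: is_derive_eq; rewrite /GRing.scale/=; field.
Qed.

End DensityFunctions.

Theorem theorem5p4 (R : realType) (d : shock_data R) (Rs : R)
    (Rw : R -> R -> R)
    (h_eos : C2_halfplane (eos d))
    (h_mass : mass_flux d != 0)
    (h_posl : 0 < dens (lstate d))
    (h_posr : 0 < dens (rstate d))
    (h_RHl : rankine_hugoniot d (lstate d))
    (h_RHr : rankine_hugoniot d (rstate d))
    (h_order : dens (lstate d) < dens (rstate d))
    (h_lax : lax_inequalities d)
    (h_pC2 : C2_pos (reduced_pressure d))
    (h_conv : convexity_criterion d)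
    (h_pconv : forall r : R, 0 < r -> 0 <= (reduced_pressure d)^`(2) r)
    (h_sonic : sonic_density d Rs)
    (h_lip : lipschitz_near (reduced_pressure d)^`(2) Rs)
    (h_wave : forall alpha : R, 0 < alpha ->
       igr_traveling_wave d Rs alpha (Rw alpha)) :
  [/\ cvg_step Rw (dens (lstate d)) (dens (rstate d)),
      cvg_step (fun alpha xi => velocity d (Rw alpha xi))
        (vel (lstate d)) (vel (rstate d)),
      cvg_step (fun alpha xi => int_energy d (Rw alpha xi))
        (state_int_energy (lstate d)) (state_int_energy (rstate d))
    & cvg_step (fun alpha xi => entropic_pressure d (Rw alpha xi)) 0 0].
Proof.
set Rl := dens (lstate d); set Rr := dens (rstate d).
pose k := Rl / Rr / 2.
have k0 : 0 < k by rewrite !divr_gt0.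
(* [Rr - Rl] exceeds both one-sided constants [Rs - Rl] and [Rr - Rs], so it serves on either side
   of the shock. *)
have C0 : 0 < Rr - Rl by rewrite subr_gt0.
have [RlRs RsRr S'Rs _] := h_sonic.
have Rw_itv (alpha xi : R) : 0 < alpha -> Rl <= Rw alpha xi <= Rr.
  by move=> /h_wave[].
have dS := is_derive_entropic_pressure h_pC2.
have SE := derive1_entropic_pressure h_pC2.
have dS1 (r : R) : 0 < r ->
    is_derive r (1 : R) (entropic_pressure d) ((entropic_pressure d)^`()%classic r).
  by move=> r0; rewrite (SE r r0); exact: dS r r0.
have dS2 := is_derive2_entropic_pressure h_pC2.
have Sdecr := derive1_entropic_pressure_decr h_pC2 h_mass h_pconv.
have SRl : entropic_pressure d Rl = 0 := entropic_pressure_dens h_mass h_posl h_RHl.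
have SRr : entropic_pressure d Rr = 0 := entropic_pressure_dens h_mass h_posr h_RHr.
have cS1 := continuous_derive1_entropic_pressure h_pC2.
have decay (alpha xi : R) : 0 < alpha -> xi != 0 ->
    `|Rw alpha xi - step Rl Rr xi| <=
      (Rr - Rl) * expR (- (k * `|xi|) / Num.sqrt alpha).
  move=> al0 xi0; have [homo_f f_itv [fNy fy] f0 [g fg weak]] := h_wave alpha al0.
  (* The weak equation says precisely that the source is the weak derivative of the flux. *)
  have fluxE : weak_derivative
      (fun x => alpha *
        ((entropic_pressure d)^`()%classic (Rw alpha x) / Rw alpha x) * g x)
      (fun x => entropic_pressure d (Rw alpha x) / Rw alpha x -
        2 * alpha * (mass_flux d ^+ 2 / Rw alpha x ^+ 4) * g x ^+ 2).
    by move=> phi /weak/eqP; rewrite addr_eq0 => /eqP.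
  move: xi0; rewrite neq_lt => /orP[xi0|xi0].
    rewrite /step xi0.
    apply: le_trans (wave_decay_left al0 h_posl dS1 dS2 Sdecr S'Rs h_pconv SRl
      RlRs homo_f f_itv f0 fg fluxE fNy xi0) _.
    by rewrite ler_wpM2r ?expR_ge0// lerD2r ltW.
  rewrite /step ltNge (ltW xi0) /=.
  apply: le_trans (wave_decay_right al0 h_posl dS1 dS2 Sdecr S'Rs h_pconv SRl
    SRr RlRs RsRr homo_f f_itv f0 fg fluxE fy xi0) _.
  by rewrite ler_wpM2r ?expR_ge0// lerD2l lerN2 ltW.
split.
- exact: decay_cvg_step C0 k0 decay.
- rewrite -(velocity_dens h_posl h_RHl) -(velocity_dens h_posr h_RHr).
  apply: (decay_cvg_step_comp h_posl (ltW h_order) C0 k0 Rw_itv decay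
    (@is_derive_velocity R d)) => r r0.
  by apply: cvgM; [exact: cvg_cst|exact: continuous_exprnV].
- rewrite -(int_energy_dens h_mass h_posl h_RHl).
  rewrite -(int_energy_dens h_mass h_posr h_RHr).
  apply: (decay_cvg_step_comp h_posl (ltW h_order) C0 k0 Rw_itv decay
    (@is_derive_int_energy R d)) => r r0.
  by apply: cvgB; apply: cvgM; first [exact: cvg_cst|exact: continuous_exprnV].
- rewrite -[X in cvg_step _ X]SRl -[X in cvg_step _ _ X]SRr.
  exact: (decay_cvg_step_comp h_posl (ltW h_order) C0 k0 Rw_itv decay dS1 cS1).
Qed.
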